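(* Let $\widetilde p\ge 1$ be an integer and consider two successive scales $j$ and $j+1$ of a two-nested multilevel grid with, in general non-equidistant, finite knot sets $\{x_{j,k}\mid k=0,\ldots,n_j-1\}$ and $\{x_{j+1,k}\mid k=0,\ldots,n_{j+1}-1\}$, so that $x_{j+1,2k}=x_{j,k}$. Knots with an index outside the grid are read according to the multiple end point convention: $x_{i,l}=x_{i,0}$ for $l<0$ and $x_{i,l}=x_{i,n_i-1}$ for $l>n_i-1$. Suppose that $s_{j+1,k}$ are scaling coefficients at scale $j+1$ defined on the knots $x_{j+1,k}$. Consider a lifting scheme with $u$ update steps and $u+r$ prediction steps, where the integer $u$ and the boolean $r$ are $$u=\lfloor(\widetilde p+1)/4\rfloor,\qquad r=\lceil\widetilde p/2\rceil-2u,$$ and let $\widetilde r=\widetilde p-2\lfloor\widetilde p/2\rfloor$ be the boolean indicating the parity of $\widetilde p$. For every $s\in\{1-r,\ldots,u\}$ define $m=u-s$, $t=r+2s-1$, $\widetilde u=\widetilde r\cdot\min(r+s,2)$, $\widetilde t=\widetilde r\cdot\min(1+s,2)$ (all depending on $s$). Construct the following lifting scheme, in which $2k$ and $2k+1$ refer to the even and odd fine scale indices. First, define the even and odd factors by $c^{[0]}_{j+1,k}=1$ for every $k$ and $$c^{[s]}_{j+1,2k}=c^{[s-1]}_{j+1,2k}\cdot\frac{x_{j+1,2k+2m+1}-x_{j+1,2k-2m-1}}{x_{j+1,2k+2m+2t}-x_{j+1,2k-2m-2t+\widetilde u}},\qquad s\in\{1,\ldots,u\},$$ $$c^{[r+s]}_{j+1,2k+1}=c^{[r+s-1]}_{j+1,2k+1}\cdot\frac{x_{j+1,2k+2m+1}-x_{j+1,2k-2m+1}}{x_{j+1,2k+2m+2t+2}-x_{j+1,2k-2m-2t+\widetilde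 t}},\qquad s\in\{1-r,\ldots,u\}.$$ Second, for $s\in\{1,\ldots,u\}$, define an update matrix $U_j^{[s]}$ as the lower bidiagonal matrix with entries $$U^{[s]}_{j,k,k}=-\frac{c^{[s-1]}_{j+1,2k}}{c^{[r+s-1]}_{j+1,2k+1}}\cdot\frac{x_{j+1,2k-2m-1}-x_{j+1,2k-2m-2t+\widetilde u}}{x_{j+1,2k+2m+2t}-x_{j+1,2k-2m-2t+\widetilde u}},$$ $$U^{[s]}_{j,k,k-1}=-\frac{c^{[s-1]}_{j+1,2k}}{c^{[r+s-1]}_{j+1,2k-1}}\cdot\frac{x_{j+1,2k+2m+2t}-x_{j+1,2k+2m+1}}{x_{j+1,2k+2m+2t}-x_{j+1,2k-2m-2t+\widetilde u}},$$ and set the lifted even coefficients $$s^{[s]}_{j+1,2k}=s^{[s-1]}_{j+1,2k}+U^{[s]}_{j,k,k-1}\,s^{[r+s-1]}_{j+1,2k-1}+U^{[s]}_{j,k,k}\,s^{[r+s-1]}_{j+1,2k+1}.$$ Third, for $s\in\{1-r,\ldots,u\}$, define a prediction matrix $P_j^{[r+s]}$ as the upper bidiagonal matrix with entries $$P^{[r+s]}_{j,k,k}=\frac{c^{[r+s-1]}_{j+1,2k+1}}{c^{[s]}_{j+1,2k}}\cdot\frac{x_{j+1,2k+2m+2t+2}-x_{j+1,2k+2m+1}}{x_{j+1,2k+2m+2t+2}-x_{j+1,2k-2m-2t+\widetilde t}},$$ $$P^{[r+s]}_{j,k,k+1}=\frac{c^{[r+s-1]}_{j+1,2k+1}}{c^{[s]}_{j+1,2k+2}}\cdot\frac{x_{j+1,2k-2m+1}-x_{j+1,2k-2m-2t+\widetilde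 t}}{x_{j+1,2k+2m+2t+2}-x_{j+1,2k-2m-2t+\widetilde t}},$$ and set the lifted odd coefficients $$s^{[r+s]}_{j+1,2k+1}=s^{[r+s-1]}_{j+1,2k+1}-P^{[r+s]}_{j,k,k}\,s^{[s]}_{j+1,2k}-P^{[r+s]}_{j,k,k+1}\,s^{[s]}_{j+1,2k+2}.$$ Here $s^{[0]}_{j+1,k}=s_{j+1,k}$, and the steps are executed for $s=1-r,\ldots,u$ in increasing order, for each $s$ first the update (only if $s\ge1$) and then the prediction. Finally, define the diagonal rescaling matrix $D_j$ by $D_{j,k,k}=c^{[u]}_{j+1,2k}$, and the scaling and detail coefficients at scale $j$ by $$s_{j,k}=D_{j,k,k}^{-1}\,s^{[u]}_{j+1,2k},\qquad d_{j,k}=s^{[r+u]}_{j+1,2k+1}.$$ Then, for every $q\in\{0,1,\ldots,\widetilde p-1\}$, the power coefficients in the B-spline basis at scale $j+1$, $s_{j+1,k}=\widetilde x^{[\widetilde p,q]}_{j+1,k}$, are transformed by this lifting scheme into coarse scaling coefficients $s_{j,k}=\widetilde x^{[\widetilde p,q]}_{j,k}$ plus detail coefficients $d_{j,k}=0$. Consequently, the refinement equation associated with this lifting scheme has the B-splines of order $\widetilde p$ on the non-equidistant knots $x_{j,k}$ as its solution.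
   Context: Multilevel grid. At each scale $j=L,L+1,\ldots,J$ there is a finite ordered set of real knots $\{x_{j,k}\mid k=0,\ldots,n_j-1\}$. The sequence $n_j$ is strictly increasing, and there are constants $R\in\mathbb R$, $\beta>0$ such that $\sup_{0\le k\le n_j-2}(x_{j,k+1}-x_{j,k})\le R\,n_j^{-\beta}$. The grid is two-nested if $x_{j+1,2k}=x_{j,k}$ at each level. B-splines. With the multiple end point convention stated in the claim, the B-splines of order 1 on the knots at scale $j$ are the characteristic functions $\varphi^{[1]}_{j,k}$ of $[x_{j,k},x_{j,k+1})$, and for order $\widetilde p\ge2$ $$\varphi^{[\widetilde p]}_{j,k}(x)=\frac{x-x_{j,k-\lfloor\widetilde p/2\rfloor}}{x_{j,k+\lceil\widetilde p/2\rceil-1}-x_{j,k-\lfloor\widetilde p/2\rfloor}}\,\varphi^{[\widetilde p-1]}_{j,k-1+\rho}(x)+\frac{x_{j,k+\lceil\widetilde p/2\rceil}-x}{x_{j,k+\lceil\widetilde p/2\rceil}-x_{j,k-\lfloor\widetilde p/2\rfloor+1}}\,\varphi^{[\widetilde p-1]}_{j,k+\rho}(x),$$ with $\rho=\widetilde p-2\lfloor\widetilde p/2\rfloor$ (a term whose denominator vanishes because of multiple end knots is read as zero). The interior interval at scale $j$ is $I_j=[x_{j,\widetilde p-1},x_{j,n_j-\widetilde p}]$. Power coefficients. For $q=0,1,\ldots,\widetilde p-1$, the power coefficients $\widetilde x^{[\widetilde p,q]}_{j,k}$ are the coefficients in $$x^q=\sum_{k\in\mathbb Z}\widetilde x^{[\widetilde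 p,q]}_{j,k}\,\varphi^{[\widetilde p]}_{j,k}(x),\qquad x\in I_j .$$ They equal $1$ for $q=0$, and for $q=1,\ldots,\widetilde p-1$ they satisfy $$\widetilde x^{[\widetilde p,q]}_{j,k}=\widetilde x^{[\widetilde p,q]}_{j,k-1}+\frac{q}{\widetilde p-1}\,\widetilde x^{[\widetilde p-1,q-1]}_{j,k-\widetilde r'}\,\bigl(x_{j,k+\lceil\widetilde p/2\rceil-1}-x_{j,k-\lfloor\widetilde p/2\rfloor}\bigr),\qquad \widetilde r'=1-\rho .$$ For $q=1$ they equal the mean, and for $q=\widetilde p-1$ the product, of the $\widetilde p-1$ knots $x_{j,k+i}$, $i=1-\lfloor\widetilde p/2\rfloor,\ldots,\lceil\widetilde p/2\rceil-1$; in general they equal $\binom{\widetilde p-1}{q}^{-1}$ times the $q$-th elementary symmetric polynomial of these knots. Refinement equation of the lifting scheme. Undoing the rescaling and the lifting steps in reverse order gives an inverse transform $\boldsymbol s_{j+1}=H_j\boldsymbol s_j+G_j^{[0]}\boldsymbol d_j$; thus column $k$ of the refinement matrix $H_j$ is the vector $\boldsymbol s_{j+1}$ reconstructed from $\boldsymbol d_j=0$ and $\boldsymbol s_j$ the $k$-th canonical vector. The associated refinement (two-scale) equation is $$\varphi_{j,k}(x)=\sum_{\ell=0}^{n_{j+1}-1}H_{j,\ell,k}\,\varphi_{j+1,\ell}(x),$$ which for the B-splines is understood on the interior interval, $x\in I_j$.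
   Formalization: If n_{j+1}=2n_j, x_{j+1,2k}=x_{j,k} fails beyond the right end under the end point convention, and so does the claim; the coefficient and refinement claims are then stated only for k whose coarse knots used satisfy it, and d_{j,k}=0 only for k<n_j-1. If n_{j+1}=2n_j-1 nothing is lost. *)

(* Defs.v *)
From HB Require Import structures.
From mathcomp Require Import all_boot all_order all_algebra.
From mathcomp Require Import all_classical all_reals all_analysis.
From mathcomp Require Import zify.

Set Implicit Arguments.
Unset Strict Implicit.
Unset Printing Implicit Defensive.

Import Order.TTheory GRing.Theory Num.Theory.
Local Open Scope ring_scope.

(* Scales and all knot, coefficient and matrix indices that may leave the grid
   are integers; x j k with k < n j are the knots at scale j.                *)

Definition multilevel_grid (R : realType) (L J : int)
    (n : int -> nat) (x : int -> nat -> R) : Prop :=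
  [/\ forall (j : int) (k : nat), L <= j <= J -> (k.+1 < n j)%N -> x j k < x j k.+1,
      forall j : int, L <= j < J -> (n j < n (j + 1)%R)%N
    & exists C beta : R, 0 < beta /\
        forall (j : int) (k : nat), L <= j <= J -> (k.+1 < n j)%N ->
          x j k.+1 - x j k <= C * (n j)%:R `^ (- beta)].

(* The coarse indices are those k for which 2k is a fine index, so n (j + 1)
   is 2 * n j - 1 or 2 * n j.                                                *)
Definition two_nested (R : realType) (L J : int)
    (n : int -> nat) (x : int -> nat -> R) : Prop :=
  forall j : int, L <= j < J ->
    n j = uphalf (n (j + 1)) /\
    forall k, (k < n j)%N -> x (j + 1) k.*2 = x j k.

(* Multiple end point convention. *)
Definition knot (R : realType) (n : nat) (x : nat -> R) (k : int) : R :=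
  match k with
  | Posz i => x (minn i n.-1)
  | Negz _ => x 0%N
  end.

(* The relation x_(j+1,2l) = x_(j,l) up to index i, with the convention above
   in force at both scales (X is the coarse, Y the fine knot sequence). On a
   two-nested grid it holds for every i if n_(j+1) = 2 n_j - 1 (see
   nested_upto_odd). If n_(j+1) = 2 n_j, the scales have different right end
   points and it holds exactly for i < n_j.                                  *)
Definition nested_upto (R : realType) (X Y : int -> R) (i : int) : Prop :=
  forall l : int, l <= i -> Y (2 * l) = X l.

Lemma nested_upto_odd (R : realType) (n n' : nat) (x x' : nat -> R) (i : int) :
  n = uphalf n' -> odd n' ->
  (forall k, (k < n)%N -> x' k.*2 = x k) ->
  nested_upto (knot n x) (knot n' x') i.
Proof.
move=> nE on' xx' l _; case: l => l.
  rewrite -PoszM /=; have -> : minn (2 * l) n'.-1 = (minn l n.-1).*2 by lia.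
  by rewrite xx'//; lia.
have -> : 2 * Negz l = Negz (l.*2.+1) by lia.
by rewrite /= -(xx' 0%N) //; lia.
Qed.

(* B-splines on the knots X; a vanishing denominator gives a zero term since
   a / 0 = 0. Order 0 is junk.                                               *)
Fixpoint bspline (R : realType) (X : int -> R) (p : nat) (k : int) (x : R)
    {struct p} : R :=
  match p with
  | 0%N => 0
  | p'.+1 =>
    if p' == 0%N then (X k <= x < X (k + 1))%R%:R
    else
      let f := (p./2)%:Z in
      let c := (uphalf p)%:Z in
      let rho := (odd p)%:Z in
      (x - X (k - f)) / (X (k + c - 1) - X (k - f))
        * bspline X p' (k - 1 + rho) x
      + (X (k + c) - x) / (X (k + c) - X (k - f + 1))
        * bspline X p' (k + rho) x
  end.

(* Binomial-normalised q-th elementary symmetric polynomial of the p - 1 knots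
   X (k + i), 1 - floor(p/2) <= i <= ceil(p/2) - 1.                          *)
Definition knot_esym_mean (R : realType) (p q : nat) (X : int -> R) (k : int)
    : R :=
  (\sum_(A : {set 'I_p.-1} | #|A| == q)
     \prod_(i in A) X (k + 1 - (p./2)%:Z + i%:Z)) / ('C(p.-1, q))%:R.

(* Coefficients of x^q in the B-spline basis on the interior interval. The
   first clause determines a k exactly when the k-th B-spline does not vanish
   identically on that interval; for the other k, the knot formula extends a.
   The interval is taken half-open because the order 1 B-splines are
   right-open: for p = 1 the identity fails at the last knot, and for p > 1
   the value there follows by continuity.                                    *)
Definition power_coefs (R : realType) (p q n : nat) (X : int -> R)
    (a : int -> R) : Prop :=
  let lo := X (p%:Z - 1) in let hi := X (n%:Z - p%:Z) in
  (forall x, lo <= x < hi ->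
     x ^+ q = \sum_(k \in [set: int]) a k * bspline X p k x) /\
  (forall k : int, (forall x, lo <= x < hi -> bspline X p k x = 0) ->
     a k = knot_esym_mean p q X k).

(* Parameters of the scheme. The truncated subtractions are exact for
   1 - r <= s <= u.                                                          *)
Definition lu (p : nat) : nat := ((p + 1) %/ 4)%N.
Definition lr (p : nat) : nat := (uphalf p - 2 * lu p)%N.
Definition lm (p s : nat) : nat := (lu p - s)%N.
Definition lt_ (p s : nat) : nat := (lr p + 2 * s - 1)%N.
Definition lutilde (p s : nat) : nat := (odd p * minn (lr p + s) 2)%N.
Definition lttilde (p s : nat) : nat := (odd p * minn (1 + s) 2)%N.

(* Y is the fine knot sequence; c_even s k is c^[s] at 2k, and c_odd i k is
   c^[i] at 2k+1, where i = r + s.                                           *)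
Fixpoint c_even (R : realType) (p : nat) (Y : int -> R) (s : nat) (k : int)
    {struct s} : R :=
  match s with
  | 0%N => 1
  | s'.+1 =>
    let m := (lm p s)%:Z in
    let t := (lt_ p s)%:Z in
    let ut := (lutilde p s)%:Z in
    c_even p Y s' k
    * ((Y (2 * k + 2 * m + 1) - Y (2 * k - 2 * m - 1))
       / (Y (2 * k + 2 * m + 2 * t) - Y (2 * k - 2 * m - 2 * t + ut)))
  end.

Fixpoint c_odd (R : realType) (p : nat) (Y : int -> R) (i : nat) (k : int)
    {struct i} : R :=
  match i with
  | 0%N => 1
  | i'.+1 =>
    let s := (i - lr p)%N in
    let m := (lm p s)%:Z in
    let t := (lt_ p s)%:Z in
    let tt := (lttilde p s)%:Z in
    c_odd p Y i' k
    * ((Y (2 * k + 2 * m + 1) - Y (2 * k - 2 * m + 1))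
       / (Y (2 * k + 2 * m + 2 * t + 2) - Y (2 * k - 2 * m - 2 * t + tt)))
  end.

(* U^[s] for 1 <= s <= u. *)
Definition update_mx (R : realType) (p : nat) (Y : int -> R) (s : nat)
    (k l : int) : R :=
  let m := (lm p s)%:Z in
  let t := (lt_ p s)%:Z in
  let ut := (lutilde p s)%:Z in
  let den := Y (2 * k + 2 * m + 2 * t) - Y (2 * k - 2 * m - 2 * t + ut) in
  if l == k then
    - (c_even p Y (s - 1) k / c_odd p Y (lr p + s - 1) k)
    * ((Y (2 * k - 2 * m - 1) - Y (2 * k - 2 * m - 2 * t + ut)) / den)
  else if l == k - 1 then
    - (c_even p Y (s - 1) k / c_odd p Y (lr p + s - 1) (k - 1))
    * ((Y (2 * k + 2 * m + 2 * t) - Y (2 * k + 2 * m + 1)) / den)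
  else 0.

(* P^[r+s] for 1 - r <= s <= u. *)
Definition predict_mx (R : realType) (p : nat) (Y : int -> R) (s : nat)
    (k l : int) : R :=
  let m := (lm p s)%:Z in
  let t := (lt_ p s)%:Z in
  let tt := (lttilde p s)%:Z in
  let den := Y (2 * k + 2 * m + 2 * t + 2) - Y (2 * k - 2 * m - 2 * t + tt) in
  if l == k then
    c_odd p Y (lr p + s - 1) k / c_even p Y s k
    * ((Y (2 * k + 2 * m + 2 * t + 2) - Y (2 * k + 2 * m + 1)) / den)
  else if l == k + 1 then
    c_odd p Y (lr p + s - 1) k / c_even p Y s (k + 1)
    * ((Y (2 * k - 2 * m + 1) - Y (2 * k - 2 * m - 2 * t + tt)) / den)
  else 0.

(* A pair (e, o) holds the even and odd coefficients, e k at 2k and o k at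
   2k+1. Coefficients with an index outside the grid are kept, as near the end
   points the bidiagonal steps refer to them.                                *)
Definition apply_update (R : realType) (p : nat) (Y : int -> R) (s : nat)
    (o : int -> R) (k : int) : R :=
  update_mx p Y s k (k - 1) * o (k - 1) + update_mx p Y s k k * o k.

Definition apply_predict (R : realType) (p : nat) (Y : int -> R) (s : nat)
    (e : int -> R) (k : int) : R :=
  predict_mx p Y s k k * e k + predict_mx p Y s k (k + 1) * e (k + 1).

Definition lift_step (R : realType) (p : nat) (Y : int -> R)
    (eo : (int -> R) * (int -> R)) (s : nat) : (int -> R) * (int -> R) :=
  let: (e, o) := eo in
  let e' := if s == 0%N then e else fun k => e k + apply_update p Y s o k in
  (e', fun k => o k - apply_predict p Y s e' k).

Definition unlift_step (R : realType) (p : nat) (Y : int -> R)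
    (eo : (int -> R) * (int -> R)) (s : nat) : (int -> R) * (int -> R) :=
  let: (e, o) := eo in
  let o' := fun k => o k + apply_predict p Y s e k in
  (if s == 0%N then e else fun k => e k - apply_update p Y s o' k, o').

(* The list 1 - r, ..., u. *)
Definition lift_indices (p : nat) : seq nat := iota (1 - lr p) (lu p + lr p).

Definition rescale_mx (R : realType) (p : nat) (Y : int -> R) (k : int) : R :=
  c_even p Y (lu p) k.

(* From the fine coefficients a to the pair (s_j, d_j). *)
Definition lifting (R : realType) (p : nat) (Y : int -> R) (a : int -> R)
    : (int -> R) * (int -> R) :=
  let: (e, o) := foldl (lift_step p Y)
                   (fun k => a (2 * k), fun k => a (2 * k + 1))
                   (lift_indices p) in
  (fun k => (rescale_mx p Y k)^-1 * e k, o).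

(* From (s_j, d_j) to the pair of even and odd fine coefficients. *)
Definition inverse_lifting (R : realType) (p : nat) (Y : int -> R)
    (sd : (int -> R) * (int -> R)) : (int -> R) * (int -> R) :=
  foldl (unlift_step p Y) (fun k => rescale_mx p Y k * sd.1 k, sd.2)
    (rev (lift_indices p)).

Definition refinement_mx (R : realType) (p : nat) (Y : int -> R) (l k : nat)
    : R :=
  let: (e, o) := inverse_lifting p Y
                   (fun i => (i == k%:Z)%:R, fun _ => 0) in
  if odd l then o (l./2)%:Z else e (l./2)%:Z.

(* Main.v *)
Require Import Defs.
From mathcomp Require Import all_boot all_order all_algebra.
From mathcomp Require Import all_classical all_reals all_analysis.
From mathcomp Require Import zify ring lra.

(** Write [p = 4u + 2r - rho] with [rho] the parity of [p].  After step [s] the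
    even coefficients are [c^[s]] times a coefficient of the product of the
    ['X + y] over an explicit set of [p - 1] knots [y] around [2k]: all knots of
    even index in a window that grows with [s], and the odd ones at distance
    less than [2(u - s)]; similarly for the odd coefficients.  A lifting step
    replaces two knots [b, c] of that set by two knots [a, d], by the identity
      [(c - b) a d = (d - a) b c - (b - a) c d - (d - c) a b].
    When [s = u] only knots of even index are left, that is coarse knots, and
    the last odd factor vanishes, so that the details are zero.  By Marsden's
    identity and the local linear independence of the B-splines, the power
    coefficients are exactly the symmetric means which are thus transformed.

    The refinement equation is the transposed computation.  Undoing the steps
    replaces the fine B-splines by multiples of divided differences of
    [y |-> (y - z)_+^(p-1)] over the same kind of knot sets, because of
      [(d - a) [a,d,F] = (c - b) [b,c,F] + (b - a) [a,b,F] + (d - c) [c,d,F],]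
    and [u] steps lead to the B-splines on the coarse knots.  This applies if
    the support of the coarse B-spline has no multiple knots; otherwise that
    B-spline vanishes on the interior interval, and so does its refinement, as
    the refinement matrix is banded.  *)

Set Implicit Arguments.
Unset Strict Implicit.
Unset Printing Implicit Defensive.

Import Order.TTheory GRing.Theory Num.Theory.
Local Open Scope ring_scope.

(** * Knot sets *)

Definition consec (b : int) (N : nat) : seq int :=
  [seq b + i%:Z | i <- iota 0 N].

Definition prog (b : int) (N : nat) : seq int :=
  [seq b + 2 * i%:Z | i <- iota 0 N].

Lemma consecS (b : int) (N : nat) : consec b N.+1 = b :: consec (b + 1) N.
Proof.
rewrite /consec /= addr0 (iotaDl 1 0) -map_comp; congr cons.
by apply: eq_map => i /=; lia.
Qed.

Lemma consecSr (b : int) (N : nat) :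
  consec b N.+1 = rcons (consec b N) (b + N%:Z).
Proof. by rewrite /consec -(addn1 N) iotaD map_cat cats1. Qed.

Lemma progS (b : int) (N : nat) : prog b N.+1 = b :: prog (b + 2) N.
Proof.
rewrite /prog /= mulr0 addr0 (iotaDl 1 0) -map_comp; congr cons.
by apply: eq_map => i /=; lia.
Qed.

Lemma progSr (b : int) (N : nat) :
  prog b N.+1 = rcons (prog b N) (b + 2 * N%:Z).
Proof. by rewrite /prog -(addn1 N) iotaD map_cat cats1. Qed.

Lemma consec_prog (b : int) (N : nat) :
  perm_eq (consec b N) (prog b (uphalf N) ++ prog (b + 1) N./2).
Proof.
elim: N b => [|N IH] b //.
rewrite consecS.
have -> : uphalf N.+1 = N./2.+1 by lia.
have -> : N.+1./2 = uphalf N by lia.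
rewrite progS cat_cons perm_cons; apply: (perm_trans (IH _)).
by rewrite -addrA perm_catC.
Qed.

Lemma mem_consec (b : int) (N : nat) (x : int) :
  (x \in consec b N) = (b <= x < b + N%:Z).
Proof.
apply/mapP/idP => [[i]|h]; first by rewrite mem_iota => ? ->; lia.
by exists `|x - b|%N; rewrite ?mem_iota; lia.
Qed.

Lemma mem_prog (b : int) (N : nat) (x : int) : x \in prog b N ->
  exists2 i : nat, (i < N)%N & x = b + 2 * i%:Z.
Proof. by case/mapP => i; rewrite mem_iota => hi ->; exists i; lia. Qed.

Lemma uniq_consec (b : int) (N : nat) : uniq (consec b N).
Proof. by rewrite map_inj_uniq ?iota_uniq // => i j; lia. Qed.

Lemma uniq_prog (b : int) (N : nat) : uniq (prog b N).
Proof. by rewrite map_inj_uniq ?iota_uniq // => i j; lia. Qed.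

Lemma uniq_prog_cat (b b' : int) (N N' : nat) :
  (forall i j : nat, b + 2 * i%:Z <> b' + 2 * j%:Z) ->
  uniq (prog b N ++ prog b' N').
Proof.
move=> h; rewrite cat_uniq !uniq_prog andbT /=; apply/hasPn => x.
move=> /mem_prog[i _ ->]; apply/negP => /mem_prog[j _] /esym.
exact: h.
Qed.

(* [eset] holds the even indices from 2k - 2a + 2 rho to 2k + 2a and the odd
   ones at distance less than 2m from 2k; [oset] holds the even indices from
   2k - 2a + 2 + 2 rho to 2k + 2a and the odd ones at distance less than 2m - 1
   from 2k + 1. *)
Definition eset (rho a m : nat) (k : int) : seq int :=
  prog (2 * k - 2 * a%:Z + 2 * rho%:Z) (2 * a + 1 - rho)
  ++ prog (2 * k - 2 * m%:Z + 1) (2 * m).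

Definition oset (rho a m : nat) (k : int) : seq int :=
  prog (2 * k - 2 * a%:Z + 2 + 2 * rho%:Z) (2 * a - rho)
  ++ prog (2 * k - 2 * m%:Z + 3) (2 * m - 1).

(** [F] is common to all five sets. [A, B, C, D] are the knots exchanged by an update at [2k]: in
    order come the new even set, the old one, those of the right and left odd neighbours, and the
    union. The transposed prediction uses the same sets; there the union serves to show that all
    knots are distinct. *)
Lemma eset_exchange (rho a m : nat) (k : int) : (rho <= 1)%N ->
  let A := 2 * k - 2 * a%:Z - 2 + 2 * rho%:Z in let B := 2 * k - 2 * m%:Z - 1 in
  let C := 2 * k + 2 * m%:Z + 1 in let D := 2 * k + 2 * a%:Z + 2 in
  let F := eset rho a m k in
  [/\ perm_eq (eset rho a.+1 m k) [:: A, D & F],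
      perm_eq (eset rho a m.+1 k) [:: B, C & F],
      perm_eq (oset rho a.+1 m.+1 k) [:: C, D & F],
      perm_eq (oset rho a.+1 m.+1 (k - 1)) [:: A, B & F]
    & perm_eq (eset rho a.+1 m.+1 k) [:: A, B, C, D & F] ].
Proof.
move=> hrho A B C D F; rewrite /F /eset /oset.
have -> : (2 * a.+1 + 1 - rho = (2 * a + 1 - rho).+2)%N by lia.
have -> : (2 * a.+1 - rho = (2 * a + 1 - rho).+1)%N by lia.
have -> : (2 * m.+1 = (2 * m).+2)%N by lia.
have -> : ((2 * m).+2 - 1 = (2 * m).+1)%N by lia.
have eA : 2 * k - 2 * a.+1%:Z + 2 * rho%:Z = A by lia.
have eB : 2 * k - 2 * m.+1%:Z + 1 = B by lia.
rewrite eA eB.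
have -> : 2 * k - 2 * a.+1%:Z + 2 + 2 * rho%:Z = A + 2 by lia.
have -> : 2 * (k - 1) - 2 * a.+1%:Z + 2 + 2 * rho%:Z = A by lia.
have -> : 2 * k - 2 * m.+1%:Z + 3 = B + 2 by lia.
have -> : 2 * (k - 1) - 2 * m.+1%:Z + 3 = B by lia.
have -> : 2 * k - 2 * a%:Z + 2 * rho%:Z = A + 2 by lia.
have -> : 2 * k - 2 * m%:Z + 1 = B + 2 by lia.
have hD : A + 2 + 2 * (2 * a + 1 - rho)%:Z = D by lia.
have hC : B + 2 + 2 * (2 * m)%:Z = C by lia.
(* Each progression is split at its first or last element; equality of multisets is then checked by
   counting an arbitrary predicate. *)
split; apply/permP => P;
rewrite ?(progS A) ?(progS B) ?(progSr (A + 2)) ?(progSr (B + 2)) ?hD ?hC /=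
  ?count_cat -?cats1 /= ?count_cat /=; ring.
Qed.

(** The analogue around [2k + 1], for the prediction and the transposed update. The bounds on [rho]
    and [m] keep the truncated subtractions in the lengths exact. *)
Lemma oset_exchange (rho a m : nat) (k : int) : (rho <= 1)%N ->
  (rho <= 2 * a)%N -> (0 < m)%N ->
  let A := 2 * k - 2 * a%:Z + 2 * rho%:Z in let B := 2 * k - 2 * m%:Z + 1 in
  let C := 2 * k + 2 * m%:Z + 1 in let D := 2 * k + 2 * a%:Z + 2 in
  let F := oset rho a m k in
  [/\ perm_eq (oset rho a.+1 m k) [:: A, D & F],
      perm_eq (oset rho a m.+1 k) [:: B, C & F],
      perm_eq (eset rho a m k) [:: A, B & F],
      perm_eq (eset rho a m (k + 1)) [:: C, D & F]
    & perm_eq (oset rho a.+1 m.+1 k) [:: A, B, C, D & F] ].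
Proof.
move=> hrho ha hm A B C D F; rewrite /F /eset /oset.
have -> : (2 * a.+1 - rho = (2 * a - rho).+2)%N by lia.
have -> : (2 * a + 1 - rho = (2 * a - rho).+1)%N by lia.
have -> : (2 * m.+1 - 1 = (2 * m - 1).+2)%N by lia.
have e2m : (2 * m = (2 * m - 1).+1)%N by lia.
have -> : 2 * k - 2 * a.+1%:Z + 2 + 2 * rho%:Z = A by lia.
have -> : 2 * k - 2 * m.+1%:Z + 3 = B by lia.
have -> : 2 * k - 2 * a%:Z + 2 + 2 * rho%:Z = A + 2 by lia.
have -> : 2 * (k + 1) - 2 * a%:Z + 2 * rho%:Z = A + 2 by lia.
have -> : 2 * (k + 1) - 2 * m%:Z + 1 = B + 2 by lia.
have -> : 2 * k - 2 * m%:Z + 3 = B + 2 by lia.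
rewrite -/A -/B.
have hD : A + 2 + 2 * (2 * a - rho)%:Z = D by lia.
have hC : B + 2 + 2 * (2 * m - 1)%:Z = C by lia.
(* These occurrences are the lengths of the odd progressions in the two even sets; the others sit
   inside [2 * m - 1]. *)
rewrite {5 7}e2m.
split; apply/permP => P;
rewrite ?(progS A) ?(progS B) ?(progSr (A + 2)) ?(progSr (B + 2)) ?hD ?hC /=
  ?count_cat -?cats1 /= ?count_cat /=; ring.
Qed.

Lemma eset_uniq (rho a m : nat) (k : int) : uniq (eset rho a m k).
Proof. by apply: uniq_prog_cat => i j; lia. Qed.

Lemma oset_uniq (rho a m : nat) (k : int) : uniq (oset rho a m k).
Proof. by apply: uniq_prog_cat => i j; lia. Qed.

(** * Exchange identities *)

Definition knot_poly (R : fieldType) (Y : int -> R) (K : seq int) : {poly R} :=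
  \prod_(i <- K) ('X + (Y i)%:P).

Lemma knot_poly_perm (R : fieldType) (Y : int -> R) (K K' : seq int) :
  perm_eq K K' -> knot_poly Y K = knot_poly Y K'.
Proof. by move=> h; rewrite /knot_poly (perm_big _ h). Qed.

Lemma knot_poly4 (R : fieldType) (Y : int -> R) (A B C D : int) (F : seq int)
    (d : nat) :
  let q K := (knot_poly Y K)`_d in
  (Y C - Y B) * q [:: A, D & F] = (Y D - Y A) * q [:: B, C & F]
    - (Y B - Y A) * q [:: C, D & F] - (Y D - Y C) * q [:: A, B & F].
Proof.
rewrite /= -!coefZ -!coefB; apply: (congr1 (fun P : {poly R} => P`_d)).
by rewrite /knot_poly !big_cons -!mul_polyC !polyCB; ring.
Qed.

(* For odd p, a = b in the first step, which is therefore a three knot exchange. *)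
Lemma knot_poly3 (R : fieldType) (Y : int -> R) (A C D : int) (F : seq int)
    (d : nat) :
  let q K := (knot_poly Y K)`_d in
  (Y C - Y A) * q (D :: F) = (Y D - Y A) * q (C :: F) - (Y D - Y C) * q (A :: F).
Proof.
rewrite /= -!coefZ -!coefB; apply: (congr1 (fun P : {poly R} => P`_d)).
by rewrite /knot_poly !big_cons -!mul_polyC !polyCB; ring.
Qed.

(** The divided difference of [g] in its Lagrange form. It has this meaning when the knots with
    indices in [K] are distinct. *)
Definition ddiff (R : fieldType) (Y : int -> R) (g : R -> R) (K : seq int) : R :=
  \sum_(i <- K) g (Y i) / \prod_(j <- K | j != i) (Y i - Y j).

Lemma ddiff_perm (R : fieldType) (Y : int -> R) (g : R -> R) (K K' : seq int) :
  perm_eq K K' -> ddiff Y g K = ddiff Y g K'.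
Proof.
move=> h; rewrite /ddiff (perm_big _ h); apply: eq_bigr => i _.
by rewrite (perm_big _ h).
Qed.

Lemma eq_ddiff (R : fieldType) (Y : int -> R) (g g' : R -> R) (K : seq int) :
  g =1 g' -> ddiff Y g K = ddiff Y g' K.
Proof. by move=> h; apply: eq_bigr => i _; rewrite h. Qed.

Lemma ddiffZ (R : fieldType) (Y : int -> R) (g : R -> R) (a : R) (K : seq int) :
  a * ddiff Y g K = ddiff Y (fun y => a * g y) K.
Proof. by rewrite /ddiff mulr_sumr; apply: eq_bigr => i _; rewrite mulrA. Qed.

Lemma ddiffD (R : fieldType) (Y : int -> R) (g h : R -> R) (K : seq int) :
  ddiff Y g K + ddiff Y h K = ddiff Y (fun y => g y + h y) K.
Proof. by rewrite /ddiff -big_split; apply: eq_bigr => i _; rewrite /= mulrDl. Qed.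

(** The factor [y - Y a] kills the term of the new knot and cancels the new denominator in every
    other term. *)
Lemma ddiff_cons (R : fieldType) (Y : int -> R) (g : R -> R) (a : int)
    (K : seq int) :
  a \notin K -> (forall i, i \in K -> Y i != Y a) ->
  ddiff Y g K = ddiff Y (fun y => (y - Y a) * g y) (a :: K).
Proof.
move=> aK hY; rewrite /ddiff big_cons subrr !mul0r add0r.
rewrite !big_seq; apply: eq_bigr => i iK; rewrite big_cons.
have -> : a != i by apply: contraNneq aK => ->.
have h : Y i - Y a != 0 by rewrite subr_eq0 hY.
by rewrite invfM mulrACA divff // mul1r.
Qed.

Section Exchange.
Variables (R : fieldType) (Y : int -> R) (g : R -> R).

Definition injseq (K : seq int) := uniq K /\ {in K &, injective Y}.

Lemma injseq_perm (K K' : seq int) : perm_eq K K' -> injseq K -> injseq K'.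
Proof.
move=> h [hu hi]; split; first by rewrite -(perm_uniq h).
by move=> i j; rewrite -!(perm_mem h); apply: hi.
Qed.

Lemma ddiff_consI (g' : R -> R) (a : int) (K : seq int) : injseq (a :: K) ->
  ddiff Y g' K = ddiff Y (fun y => (y - Y a) * g' y) (a :: K).
Proof.
move=> [/= /andP[aK _] hi]; apply: ddiff_cons => // i iK.
apply/eqP => /hi; rewrite !inE iK eqxx orbT => /(_ isT isT) ia.
by move: aK; rewrite -ia iK.
Qed.

Lemma injseq_cons (a : int) (K : seq int) : injseq (a :: K) -> injseq K.
Proof.
move=> [/= /andP[_ h] hi]; split=> // i j iK jK; apply: hi;
by rewrite inE (iK, jK) orbT.
Qed.

(** Each divided difference lacks two of the knots [A, B, C, D]. Adding these turns it into one over
    the full set, with [g] multiplied by two linear factors, and an identity between quadratic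
    polynomials in [y] is left. *)
Lemma ddiff4 (A B C D : int) (F : seq int) : injseq [:: A, B, C, D & F] ->
  (Y D - Y A) * ddiff Y g [:: A, D & F] =
  (Y C - Y B) * ddiff Y g [:: B, C & F] + (Y B - Y A) * ddiff Y g [:: A, B & F]
  + (Y D - Y C) * ddiff Y g [:: C, D & F].
Proof.
move=> hi.
have two a b K : perm_eq [:: a, b & K] [:: A, B, C, D & F] ->
    ddiff Y g K = ddiff Y (fun y => (y - Y a) * ((y - Y b) * g y)) [:: A, B, C, D & F].
  move=> hp; have hi' : injseq [:: a, b & K].
    by apply: injseq_perm hi; rewrite perm_sym.
  by rewrite -(ddiff_perm _ _ hp) -ddiff_consI // -ddiff_consI //; apply: injseq_cons hi'.
rewrite (two B C); last by apply/permP => P /=; lia.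
rewrite (two A D); last by apply/permP => P /=; lia.
rewrite (two C D); last by apply/permP => P /=; lia.
rewrite (two A B); last by apply/permP => P /=; lia.
by rewrite !ddiffZ !ddiffD; apply: eq_ddiff => y; ring.
Qed.

(** The degenerate exchange with [A = B], which occurs in the first step for odd [p]. *)
Lemma ddiff3 (A C D : int) (F : seq int) : injseq [:: A, C, D & F] ->
  (Y D - Y A) * ddiff Y g [:: A, D & F] =
  (Y C - Y A) * ddiff Y g [:: A, C & F] + (Y D - Y C) * ddiff Y g [:: C, D & F].
Proof.
move=> hi.
have one a K : perm_eq (a :: K) [:: A, C, D & F] ->
    ddiff Y g K = ddiff Y (fun y => (y - Y a) * g y) [:: A, C, D & F].
  move=> hp; have hi' : injseq (a :: K).
    by apply: injseq_perm hi; rewrite perm_sym.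
  by rewrite -(ddiff_perm _ _ hp) -ddiff_consI.
rewrite (one C); last by apply/permP => P /=; lia.
rewrite (one D); last by apply/permP => P /=; lia.
rewrite (one A); last by apply/permP => P /=; lia.
by rewrite !ddiffZ !ddiffD; apply: eq_ddiff => y; ring.
Qed.

End Exchange.

(** * Marsden's identity *)

(* B-splines indexed by their first knot instead of their central one. *)
Fixpoint nspl (R : realType) (X : int -> R) (p : nat) (i : int) (z : R)
    {struct p} : R :=
  match p with
  | 0%N => 0
  | p'.+1 =>
    if p' == 0%N then (X i <= z < X (i + 1))%R%:R
    else
      (z - X i) / (X (i + p'%:Z) - X i) * nspl X p' i z
      + (X (i + p%:Z) - z) / (X (i + p%:Z) - X (i + 1)) * nspl X p' (i + 1) z
  end.

Lemma nsplSS (R : realType) (X : int -> R) (p : nat) (i : int) (z : R) :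
  nspl X p.+2 i z =
    (z - X i) / (X (i + p.+1%:Z) - X i) * nspl X p.+1 i z
    + (X (i + p.+2%:Z) - z) / (X (i + p.+2%:Z) - X (i + 1)) * nspl X p.+1 (i + 1) z.
Proof. by []. Qed.

Lemma bspline_nspl (R : realType) (X : int -> R) (p : nat) (k : int) (z : R) :
  bspline X p k z = nspl X p (k - (p./2)%:Z) z.
Proof.
elim: p k => [//|[|p] IH] k; first by rewrite /= subr0.
rewrite nsplSS.
have -> : bspline X p.+2 k z =
  (z - X (k - (p.+2./2)%:Z)) / (X (k + (uphalf p.+2)%:Z - 1) - X (k - (p.+2./2)%:Z))
        * bspline X p.+1 (k - 1 + (odd p.+2)%:Z) z
      + (X (k + (uphalf p.+2)%:Z) - z) / (X (k + (uphalf p.+2)%:Z) - X (k - (p.+2./2)%:Z + 1))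
        * bspline X p.+1 (k + (odd p.+2)%:Z) z by [].
rewrite !IH.
have -> : k + (uphalf p.+2)%:Z - 1 = k - (p.+2./2)%:Z + p.+1%:Z by lia.
have -> : k + (uphalf p.+2)%:Z = k - (p.+2./2)%:Z + p.+2%:Z by lia.
have -> : k - 1 + (odd p.+2)%:Z - (p.+1./2)%:Z = k - (p.+2./2)%:Z by lia.
by have -> : k + (odd p.+2)%:Z - (p.+1./2)%:Z = k - (p.+2./2)%:Z + 1 by lia.
Qed.

(** Vieta's formula: when the product is expanded over subsets of the knots, a subset of cardinality
    [q] contributes in degree [p.-1 - q]. *)
Lemma knot_esym_meanE (R : realType) (p q : nat) (X : int -> R) (k : int) :
  (q <= p.-1)%N ->
  knot_esym_mean p q X k =
  (knot_poly X (consec (k - (p./2)%:Z + 1) p.-1))`_(p.-1 - q) / ('C(p.-1, q))%:R.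
Proof.
move=> hq; rewrite /knot_esym_mean; congr (_ / _).
rewrite /knot_poly /consec big_map.
have -> : \prod_(j <- iota 0 p.-1) ('X + (X (k - (p./2)%:Z + 1 + j%:Z))%:P) =
    \prod_(i < p.-1) ((X (k + 1 - (p./2)%:Z + i%:Z))%:P + 'X) :> {poly R}.
  have -> : iota 0 p.-1 = index_iota 0 p.-1 by rewrite /index_iota subn0.
  rewrite big_mkord; apply: eq_bigr => i _.
  by rewrite addrC; have -> : k - (p./2)%:Z + 1 + i%:Z = k + 1 - (p./2)%:Z + i%:Z by lia.
rewrite bigA_distr coef_sum [RHS](bigID (fun A : {set 'I_p.-1} => #|A| == q)) /=.
have split_prod (A : {set 'I_p.-1}) :
    \prod_(i < p.-1) (if i \in A then (X (k + 1 - (p./2)%:Z + i%:Z))%:P else 'X)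
    = (\prod_(i in A) X (k + 1 - (p./2)%:Z + i%:Z))%:P * 'X^(p.-1 - #|A|).
  rewrite (bigID (mem A)) /= rmorph_prod; congr (_ * _).
    by apply: eq_bigr => i ->.
  rewrite (eq_bigr (fun => 'X)); last by move=> i /negbTE ->.
  rewrite prodr_const; congr (_ ^+ _).
  have hC := cardsC A; rewrite card_ord in hC.
  transitivity #|~: A|; first by apply: eq_card => i; rewrite !inE.
  by move: hC; set c := #|A|; set d := #|~: A|; lia.
rewrite [X in _ = _ + X]big1 ?addr0.
  apply: eq_bigr => A /eqP hA.
  by rewrite split_prod coefCM coefXn hA eqxx mulr1.
move=> A hA; rewrite split_prod coefCM coefXn.
have hc : (#|A| <= p.-1)%N by rewrite -[X in (_ <= X)%N](card_ord p.-1) max_card.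
have -> : (p.-1 - q == p.-1 - #|A|)%N = false; last by rewrite mulr0.
by move: hA hc; move: #|A| => c; lia.
Qed.

Section Marsden.
Variables (R : realType) (X : int -> R).
Hypothesis Xmono : forall i j, i <= j -> X i <= X j.

Lemma nspl_lt (p : nat) (i : int) (z : R) : z < X i -> nspl X p i z = 0.
Proof.
elim: p i => [//|[|p] IH] i hz; first by rewrite /= leNgt hz.
rewrite nsplSS !IH ?mulr0 ?addr0 //.
by apply: lt_le_trans hz _; apply: Xmono; lia.
Qed.

Lemma nspl_ge (p : nat) (i : int) (z : R) : X (i + p%:Z) <= z -> nspl X p i z = 0.
Proof.
elim: p i => [//|[|p] IH] i hz; first by rewrite /= ltNge hz andbF.
rewrite nsplSS !IH ?mulr0 ?addr0 //.
  by apply: le_trans hz; apply: Xmono; lia.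
by apply: le_trans hz; apply: Xmono; lia.
Qed.

Lemma nspl_const (p : nat) (i : int) (z : R) : X i = X (i + p%:Z) -> nspl X p i z = 0.
Proof.
move=> h; case: (ltP z (X i)) => [|hz]; first exact: nspl_lt.
by apply: nspl_ge; rewrite -h.
Qed.

(** At [z = X i] the first term of the recursion has the factor [z - X i], and the second B-spline
    starts at a later knot. This allows closing the interior interval on the right. *)
Lemma nspl_start (p : nat) (i : int) (z : R) : (1 < p)%N ->
  z <= X i -> X i < X (i + 1) -> nspl X p i z = 0.
Proof.
case: p => [|[|p]] // _ hz hX; rewrite nsplSS [X in _ + _ * X]nspl_lt.
  move: hz; rewrite le_eqVlt => /predU1P[-> | hz]; first by rewrite subrr; ring.
  by rewrite nspl_lt //; ring.
exact: le_lt_trans hX.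
Qed.

(** Induction on the order. Collected by the B-splines of lower order, the recursion combines two
    products that differ in one knot, and the weights [w] and [v] interpolate [z] affinely between
    these two knots, which yields one more factor ['X + z]. *)
Lemma marsden (p : nat) (i : int) (z : R) : X i <= z < X (i + 1) ->
  \sum_(t < p.+1) nspl X p.+1 (i - t%:Z) z
     *: knot_poly X (consec (i - t%:Z + 1) p) = ('X + z%:P) ^+ p.
Proof.
move=> /andP[hiz hzi]; elim: p => [|p IH].
  by rewrite big_ord1 /knot_poly /= big_nil subr0 hiz hzi scale1r.
pose w j := (z - X j) / (X (j + p.+1%:Z) - X j).
pose v j := (X (j + p.+1%:Z) - z) / (X (j + p.+1%:Z) - X j).
pose n j := nspl X p.+1 j z.
pose K j := knot_poly X (consec (j + 1) p.+1).
have nE j : nspl X p.+2 j z = w j * n j + v (j + 1) * n (j + 1).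
  rewrite nsplSS /w /v /n; have -> : j + 1 + p.+1%:Z = j + p.+2%:Z by lia.
  by [].
transitivity (\sum_(t < p.+2) (w (i - t%:Z) * n (i - t%:Z)) *: K (i - t%:Z)
  + \sum_(t < p.+2) (v (i - t%:Z + 1) * n (i - t%:Z + 1)) *: K (i - t%:Z)).
  by rewrite -big_split; apply: eq_bigr => t _; rewrite nE scalerDl.
rewrite [X in X + _ = _]big_ord_recr [X in _ + X = _]big_ord_recl /=.
(* The extreme B-splines vanish on the knot interval of [z]; without them both sums run over the
   same [p.+1] lower order B-splines. *)
have -> : n (i - p.+1%:Z) = 0 by apply: nspl_ge; rewrite subrK.
have -> : n (i - 0 + 1) = 0 by apply: nspl_lt; rewrite subr0.
rewrite !mulr0 !scale0r addr0 add0r -big_split exprS -IH mulr_sumr.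
apply: eq_bigr => t _ /=.
have -> : i - (bump 0 t)%:Z + 1 = i - t%:Z by rewrite /bump; lia.
have -> : i - (bump 0 t)%:Z = i - t%:Z - 1 by rewrite /bump; lia.
set j := i - t%:Z.
rewrite -/(n j) /K subrK [consec (j + 1) p.+1]consecSr [consec j p.+1]consecS.
rewrite /knot_poly -cats1 big_cat !big_cons big_nil /= mulr1.
have hX : X (j + p.+1%:Z) - X j != 0.
  rewrite subr_eq0 gt_eqF //.
  have h1 : X j <= X i by apply: Xmono; rewrite /j; lia.
  have h2 : X (i + 1) <= X (j + p.+1%:Z).
    by apply: Xmono; rewrite /j; have := ltn_ord t; lia.
  exact: le_lt_trans h1 (le_lt_trans hiz (lt_le_trans hzi h2)).
have -> : j + 1 + p%:Z = j + p.+1%:Z by lia.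
rewrite -!mul_polyC.
set Q := \big[_/_]_(_ <- _) _.
suff -> : 'X + z%:P = (w j)%:P * ('X + (X (j + p.+1%:Z))%:P)
           + (v j)%:P * ('X + (X j)%:P) :> {poly R} by rewrite !polyCM; ring.
have e1 : w j + v j = 1 by rewrite /w /v; field.
have e2 : w j * X (j + p.+1%:Z) + v j * X j = z by rewrite /w /v; field.
move: (w j) (v j) e1 e2 => wj vj e1 <-.
by rewrite polyCD !polyCM -[X in X + _]mul1r -polyC1 -e1 polyCD; ring.
Qed.

End Marsden.

(** * Local linear independence and uniqueness of the power coefficients *)

Section LocalIndependence.
Variables (R : realType) (X : int -> R).
Hypothesis Xmono : forall i j, i <= j -> X i <= X j.

Lemma coef_XaddC_exp (z : R) (n q : nat) : (q <= n)%N ->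
  (('X + z%:P) ^+ n)`_(n - q) = z ^+ q * ('C(n, q))%:R.
Proof.
move=> hq; rewrite exprDn coef_sum (bigD1 (Ordinal (hq : (q < n.+1)%N))) //=.
rewrite big1 ?addr0 => [|i hi]; rewrite coefMn -polyC_exp coefMC coefXn.
  by rewrite eqxx mul1r mulr_natr.
have hne : val i != q by apply: contra hi => /eqP h; apply/eqP/val_inj.
have -> : (n - q == n - i)%N = false.
  by have := ltn_ord i; move: hne => /=; move: (nat_of_ord i) => c; lia.
by rewrite mul0r mul0rn.
Qed.

Lemma marsden_power (p q : nat) (i : int) (z : R) : (q <= p)%N ->
  X i <= z < X (i + 1) ->
  \sum_(t < p.+1) (knot_poly X (consec (i - t%:Z + 1) p))`_(p - q) / ('C(p, q))%:R
     * nspl X p.+1 (i - t%:Z) z = z ^+ q.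
Proof.
move=> hq hz; have := congr1 (fun P : {poly R} => P`_(p - q)) (marsden Xmono p hz).
rewrite coef_XaddC_exp // coef_sum => h.
have hC : ('C(p, q))%:R != 0 :> R by rewrite pnatr_eq0 -lt0n bin_gt0.
apply: (mulIf hC); rewrite -h mulr_suml; apply: eq_bigr => t _.
by rewrite coefZ mulrAC divfK // mulrC.
Qed.

(** The B-splines are sampled at [p.+1] points of the interval. By Marsden's identity the matrix of
    samples times the matrix of power coefficients is a transposed Vandermonde matrix, so the former
    is invertible. *)
Lemma nspl_local_free (p : nat) (i : int) (b : nat -> R) : X i < X (i + 1) ->
  (forall z, X i <= z < X (i + 1) ->
     \sum_(t < p.+1) b t * nspl X p.+1 (i - t%:Z) z = 0) ->
  forall t, (t <= p)%N -> b t = 0.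
Proof.
move=> hX hb t ht.
(* With this spacing the points [X i + k * h], [k <= p], are distinct and stay inside the right-open
   interval. *)
pose h := (X (i + 1) - X i) / p.+1%:R.
have h_gt0 : 0 < h by rewrite divr_gt0 ?subr_gt0 ?ltr0n.
pose z (k : 'I_p.+1) := X i + k%:R * h.
have hz k : X i <= z k < X (i + 1).
  rewrite /z lerDl mulr_ge0 ?ler0n ?(ltW h_gt0) //= -ltrBrDl.
  rewrite /h mulrA ltr_pdivrMr ?ltr0n // mulrC ltr_pM2l ?subr_gt0 //.
  by rewrite ltr_nat ltn_ord.
pose N := \matrix_(k < p.+1, t < p.+1) nspl X p.+1 (i - t%:Z) (z k).
pose Xi := \matrix_(t < p.+1, q < p.+1)
  ((knot_poly X (consec (i - t%:Z + 1) p))`_(p - q) / ('C(p, q))%:R).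
have NXi : (N *m Xi)^T = Vandermonde p.+1 (\row_k z k).
  apply/matrixP => q k; rewrite !mxE -(@marsden_power p q i) //; last first.
    by rewrite -ltnS ltn_ord.
  by apply: eq_bigr => s _; rewrite !mxE mulrC.
have Nu : N \in unitmx.
  have : (N *m Xi)^T \in unitmx.
    rewrite NXi unitmxE det_Vandermonde unitfE prodf_seq_neq0.
    apply/allP => k _ /=; rewrite prodf_seq_neq0; apply/allP => l _ /=.
    apply/implyP => kl; rewrite !mxE subr_eq0 /z.
    apply/eqP => /addrI /(mulIf (lt0r_neq0 h_gt0)) /eqP; rewrite eqr_nat.
    by move=> e; rewrite (eqP e) ltnn in kl.
  by rewrite unitmx_tr unitmx_mul => /andP[].
pose v := \col_(t < p.+1) b t.
have Nv : N *m v = 0.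
  apply/matrixP => k l; rewrite !mxE -[RHS](hb (z k)) //.
  by apply: eq_bigr => s _; rewrite !mxE mulrC.
have v0 : v = 0 by rewrite -(mulKmx Nu v) Nv mulmx0.
by have /matrixP /(_ (Ordinal (ht : (t < p.+1)%N)) 0) := v0; rewrite !mxE.
Qed.

Lemma knot_interval (i j : int) (z : R) : X i <= z < X j ->
  exists2 l, i <= l < j & X l <= z < X (l + 1).
Proof.
move=> /andP[h1 h2].
have ij : i < j by rewrite ltNge; apply/negP => /Xmono; lra.
have [d dE] : exists d : nat, j = i + d%:Z + 1 by exists (absz (j - i - 1)%R); lia.
subst j; clear ij; elim: d h2 => [|d IH] h2.
  by exists i; rewrite ?h1 ?addr0 in h2 *; rewrite ?h2; lia.
case: (ltP z (X (i + d%:Z + 1))) => [/IH [l hl hz]|h3]; first by exists l => //; lia.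
exists (i + d%:Z + 1); first lia.
by rewrite h3 /=; have -> : i + d%:Z + 1 + 1 = i + d.+1%:Z + 1 by lia.
Qed.

(** Only the B-splines whose first knot has index [i - p, ..., i] can be nonzero at [z]. *)
Lemma fsum_bspline (p : nat) (a : int -> R) (i : int) (z : R) :
  X i <= z < X (i + 1) ->
  \sum_(k \in [set: int]) a k * bspline X p.+1 k z =
  \sum_(t < p.+1) a (i - t%:Z + (p.+1./2)%:Z) * nspl X p.+1 (i - t%:Z) z.
Proof.
move=> /andP[h1 h2].
rewrite (fsbigE [seq i - t%:Z + (p.+1./2)%:Z | t <- iota 0 p.+1]) //.
- rewrite -[iota 0 p.+1]/(index_iota 0 p.+1) big_map big_mkcond big_mkord.
  apply: eq_bigr => t _; rewrite in_setT bspline_nspl; congr (_ * nspl _ _ _ _).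
  by rewrite addrK.
- by rewrite map_inj_uniq ?iota_uniq // => s t; lia.
- move=> k _ /mapP hk; rewrite bspline_nspl.
  case: (lerP (k - (p.+1./2)%:Z) i) => hki; last first.
    by rewrite nspl_lt ?mulr0 //; apply: lt_le_trans h2 _; apply: Xmono; lia.
  case: (lerP (k - (p.+1./2)%:Z + p.+1%:Z) i) => hki'.
    by rewrite nspl_ge ?mulr0 //; apply: le_trans h1; apply: Xmono.
  case: hk; exists (absz (i + (p.+1./2)%:Z - k)%R); first by rewrite mem_iota; lia.
  by lia.
Qed.

(** If the B-spline vanishes on the interior interval, the second clause of [power_coefs] applies.
    Otherwise it is nonzero at some [z]; on the knot interval of [z] both [a] and the symmetric
    means represent the same power, so local independence identifies them. *)
Lemma power_coefs_unique (p q n : nat) (a : int -> R) : (q < p)%N ->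
  power_coefs p q n X a -> forall k, a k = knot_esym_mean p q X k.
Proof.
case: p => [//|p] hq [hpow hext] k.
set lo := X (p.+1%:Z - 1) in hpow hext; set hi := X (n%:Z - p.+1%:Z) in hpow hext.
have [/hext //|] := pselect (forall x, lo <= x < hi -> bspline X p.+1 k x = 0).
move=> /existsNP[z /not_implyP[hz /eqP]].
have [i hi1 hzi] := knot_interval hz.
rewrite bspline_nspl => nz.
have ki : k - (p.+1./2)%:Z <= i.
  rewrite leNgt; apply: contraNN nz => h; rewrite nspl_lt //.
  by case/andP: hzi => _ h2; apply: lt_le_trans h2 _; apply: Xmono; lia.
have ik : i < k - (p.+1./2)%:Z + p.+1%:Z.
  rewrite ltNge; apply: contraNN nz => h; rewrite nspl_ge //.
  by case/andP: hzi => h1 _; apply: le_trans h1; apply: Xmono.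
pose b t := a (i - t%:Z + (p.+1./2)%:Z)
            - (knot_poly X (consec (i - t%:Z + 1) p))`_(p - q) / ('C(p, q))%:R.
have hb : forall t, (t <= p)%N -> b t = 0.
  apply: (@nspl_local_free p i b); first by case/andP: hzi; apply: le_lt_trans.
  move=> y hy; have hy' : lo <= y < hi.
    case/andP: hy => y1 y2; apply/andP; split.
      by apply: le_trans y1; apply: Xmono; lia.
    by apply: lt_le_trans y2 _; apply: Xmono; lia.
  have e := hpow _ hy'; rewrite (fsum_bspline p a hy) in e.
  transitivity (y ^+ q - y ^+ q); last by rewrite subrr.
  rewrite {1}e -(@marsden_power p q i y) //.
  by rewrite -sumrB; apply: eq_bigr => t _; rewrite /b mulrBl.
rewrite knot_esym_meanE //.
have := hb (absz (i + (p.+1./2)%:Z - k)%R); rewrite /b => /(_ _)/subr0_eq.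
have -> : i - (absz (i + (p.+1./2)%:Z - k)%R)%:Z + (p.+1./2)%:Z = k by lia.
have -> : i - (absz (i + (p.+1./2)%:Z - k)%R)%:Z = k - (p.+1./2)%:Z by lia.
by apply; lia.
Qed.

End LocalIndependence.

(** * B-splines as divided differences of truncated powers *)

Section DividedDifference.
Variables (R : realType) (X : int -> R).

(** The truncated power. The strict inequality as a separate factor makes exponent 0 a step function
    that matches the right-open B-splines of order 1. *)
Definition tpow (z : R) (p : nat) (y : R) : R := (y - z) ^+ p * (z < y)%R%:R.

(** Both lower order divided differences are extended to the full knot set by one linear factor.
    With [a] and [b] the first and last knots, [(z - a)(y - b) + (b - z)(y - a) = (b - a)(y - z)],
    and the factor [y - z] raises the truncated power. *)
Lemma nspl_ddiff (p : nat) (i : int) (z : R) :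
  (forall k l : int, i <= k -> k < l -> l <= i + p.+1%:Z -> X k < X l) ->
  nspl X p.+1 i z =
  (X (i + p.+1%:Z) - X i) * ddiff X (tpow z p) (consec i p.+2).
Proof.
elim: p i => [|p IH] i hX.
  have h : X i < X (i + 1) by apply: hX; lia.
  rewrite /ddiff /consec /= addr0 !big_cons !big_nil !mulr1 !eqxx /= !addr0.
  have -> : (i == i + 1) = false by lia.
  have -> : (i + 1 == i) = false by lia.
  rewrite /= /tpow !expr0 !mul1r !mulr1.
  have e1 : X (i + 1) - X i != 0 by rewrite subr_eq0 gt_eqF.
  have e2 : X i - X (i + 1) != 0 by rewrite subr_eq0 lt_eqF.
  by case: (ltP z (X i)); case: (ltP z (X (i + 1))); rewrite /= => *; try field; lra.
pose g y := tpow z p y.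
have gS y : tpow z p.+1 y = (y - z) * g y by rewrite /g /tpow exprS mulrA.
set K := consec i p.+3.
have inj : injseq X K.
  split; first exact: uniq_consec.
  move=> k l; rewrite !mem_consec => hk hl; case: (ltgtP k l) => // kl e.
    by have := hX k l; rewrite e ltxx; lia.
  by have := hX l k; rewrite e ltxx; lia.
have e1 : ddiff X g (consec i p.+2) = ddiff X (fun y => (y - X (i + p.+2%:Z)) * g y) K.
  have hp : perm_eq K ((i + p.+2%:Z) :: consec i p.+2).
    by rewrite /K consecSr perm_rcons.
  rewrite (ddiff_perm _ _ hp); apply: ddiff_consI; exact: injseq_perm inj.
have e2 : ddiff X g (consec (i + 1) p.+2) = ddiff X (fun y => (y - X i) * g y) K.
  by rewrite /K (consecS i); apply: ddiff_consI; rewrite -consecS.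
rewrite nsplSS IH; last by move=> k l *; apply: hX; lia.
rewrite IH; last by move=> k l *; apply: hX; lia.
have -> : i + 1 + p.+1%:Z = i + p.+2%:Z by lia.
have n1 : X (i + p.+1%:Z) - X i != 0.
  by rewrite subr_eq0 gt_eqF //; apply: hX; lia.
have n2 : X (i + p.+2%:Z) - X (i + 1) != 0.
  by rewrite subr_eq0 gt_eqF //; apply: hX; lia.
rewrite !mulrA !divfK // e1 e2 !ddiffZ ddiffD; apply: eq_ddiff => y.
by rewrite gS; ring.
Qed.

End DividedDifference.

(** * The lifting factors *)

Lemma lu_lr (p : nat) : (p + odd p = 4 * lu p + 2 * lr p)%N.
Proof. by rewrite /lr /lu; lia. Qed.

Lemma lr_le1 (p : nat) : (lr p <= 1)%N.
Proof. by rewrite /lr /lu; lia. Qed.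

Lemma lutilde_le (p s : nat) : (lutilde p s <= minn (lr p + s) 2)%N.
Proof. by rewrite /lutilde; case: (odd p); rewrite ?mul1n ?mul0n; lia. Qed.

Lemma lttilde_le (p s : nat) : (lttilde p s <= minn (1 + s) 2)%N.
Proof. by rewrite /lttilde; case: (odd p); rewrite ?mul1n ?mul0n; lia. Qed.

Lemma lutilde_reg (p s : nat) : (2 <= lr p + s)%N -> lutilde p s = (2 * odd p)%N.
Proof. by rewrite /lutilde; case: (odd p); rewrite ?mul1n ?mul0n; lia. Qed.

Lemma lttilde_reg (p s : nat) : (1 <= s)%N -> lttilde p s = (2 * odd p)%N.
Proof. by rewrite /lttilde; case: (odd p); rewrite ?mul1n ?mul0n; lia. Qed.

Lemma lutilde1 (p s : nat) : (lr p + s = 1)%N -> lutilde p s = odd p.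
Proof. by rewrite /lutilde => ->; case: (odd p). Qed.

Lemma lttilde0 (p : nat) : lttilde p 0 = odd p.
Proof. by rewrite /lttilde; case: (odd p). Qed.

Lemma lm_subn (p s : nat) : lm p s = (lu p - s)%N. Proof. by []. Qed.

Lemma lt_subn (p s : nat) : lt_ p s = (lr p + 2 * s - 1)%N. Proof. by []. Qed.

(** The four knots of the exchange: [C - B] over [D - A] is the new factor of [c], while [B - A] and
    [D - C] are the numerators of the matrix entries. The [prd_] indices do the same for the
    prediction. *)
Definition upd_A (p s : nat) (k : int) : int :=
  2 * k - 2 * (lm p s)%:Z - 2 * (lt_ p s)%:Z + (lutilde p s)%:Z.
Definition upd_B (p s : nat) (k : int) : int := 2 * k - 2 * (lm p s)%:Z - 1.
Definition upd_C (p s : nat) (k : int) : int := 2 * k + 2 * (lm p s)%:Z + 1.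
Definition upd_D (p s : nat) (k : int) : int :=
  2 * k + 2 * (lm p s)%:Z + 2 * (lt_ p s)%:Z.

Definition prd_A (p s : nat) (k : int) : int :=
  2 * k - 2 * (lm p s)%:Z - 2 * (lt_ p s)%:Z + (lttilde p s)%:Z.
Definition prd_B (p s : nat) (k : int) : int := 2 * k - 2 * (lm p s)%:Z + 1.
Definition prd_C (p s : nat) (k : int) : int := 2 * k + 2 * (lm p s)%:Z + 1.
Definition prd_D (p s : nat) (k : int) : int :=
  2 * k + 2 * (lm p s)%:Z + 2 * (lt_ p s)%:Z + 2.

Section Factors.
Variables (R : realType) (p : nat) (Y : int -> R) (w : int).
(** The shape given by the multiple end point convention, [w] being the last index: knots may
    coincide only if both indices are at most 0 or both at least [w]. *)
Hypothesis Ystrict : forall i j, i < j -> 0 < j -> i < w -> Y i < Y j.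

(* The ranges of k on which the factors c^[s] are nonzero, m = u - s. *)
Definition even_range (m : nat) (k : int) : bool :=
  (- 2 * m%:Z <= 2 * k) && (2 * k <= w + 2 * m%:Z).
Definition odd_range (m : nat) (k : int) : bool :=
  (- 2 * m%:Z <= 2 * k) && (2 * k + 2 <= w + 2 * m%:Z).

Lemma c_evenS (s : nat) (k : int) :
  c_even p Y s.+1 k = c_even p Y s k *
    ((Y (upd_C p s.+1 k) - Y (upd_B p s.+1 k))
     / (Y (upd_D p s.+1 k) - Y (upd_A p s.+1 k))).
Proof. by []. Qed.

Lemma c_oddS (s : nat) (k : int) : (0 < lr p + s)%N ->
  c_odd p Y (lr p + s) k = c_odd p Y (lr p + s).-1 k *
    ((Y (prd_C p s k) - Y (prd_B p s k)) / (Y (prd_D p s k) - Y (prd_A p s k))).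
Proof.
case e: (lr p + s)%N => [//|i] _.
by rewrite [LHS]/= (_ : (i.+1 - lr p)%N = s) // -e addKn.
Qed.

Lemma upd_den (s : nat) (k : int) : (1 <= s <= lu p)%N -> even_range (lm p s) k ->
  0 < Y (upd_D p s k) - Y (upd_A p s k).
Proof.
rewrite /even_range => hs hk; rewrite subr_gt0.
have hu := lutilde_le p s.
by apply: Ystrict; rewrite /upd_A /upd_D ?lt_subn; lia.
Qed.

Lemma upd_num (s : nat) (k : int) : even_range (lm p s) k ->
  0 < Y (upd_C p s k) - Y (upd_B p s k).
Proof.
by rewrite /even_range => hk; rewrite subr_gt0; apply: Ystrict;
  rewrite /upd_B /upd_C; lia.
Qed.

Lemma prd_den (s : nat) (k : int) : (1 <= lr p + s)%N ->
  odd_range (lm p s) k -> 0 < Y (prd_D p s k) - Y (prd_A p s k).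
Proof.
rewrite /odd_range => hs hk; rewrite subr_gt0.
have hu := lttilde_le p s; have hr := lr_le1 p.
by apply: Ystrict; rewrite /prd_A /prd_D ?lt_subn; lia.
Qed.

(** The bound on [s] is strict: at [s = lu p] the indices [B] and [C] coincide, and the last odd
    factor is zero. *)
Lemma prd_num (s : nat) (k : int) : (s < lu p)%N ->
  odd_range (lm p s) k -> 0 < Y (prd_C p s k) - Y (prd_B p s k).
Proof.
by rewrite /odd_range lm_subn => hs hk; rewrite subr_gt0; apply: Ystrict;
  rewrite /prd_B /prd_C ?lm_subn; lia.
Qed.

Lemma even_range_le (m m' : nat) (k : int) : (m <= m')%N ->
  even_range m k -> even_range m' k.
Proof. by rewrite /even_range; lia. Qed.

Lemma odd_range_le (m m' : nat) (k : int) : (m <= m')%N ->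
  odd_range m k -> odd_range m' k.
Proof. by rewrite /odd_range; lia. Qed.

Lemma c_even_neq0 (s : nat) (k : int) : (s <= lu p)%N ->
  even_range (lm p s) k -> c_even p Y s k != 0.
Proof.
elim: s => [|s IH] hs hk; first exact: oner_neq0.
have hk' : even_range (lm p s) k by apply: even_range_le hk; rewrite /lm; lia.
rewrite c_evenS mulf_neq0 ?IH //; first lia.
by rewrite mulf_neq0 ?invr_eq0 ?lt0r_neq0 ?upd_num ?upd_den; rewrite ?hs.
Qed.

Lemma c_odd_neq0 (i : nat) (k : int) : (i < lr p + lu p)%N ->
  odd_range (lr p + lu p - i) k -> c_odd p Y i k != 0.
Proof.
elim: i => [|i IH] hi hk; first exact: oner_neq0.
have hr := lr_le1 p.
have hk' : odd_range (lr p + lu p - i) k by apply: odd_range_le hk; lia.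
have [s is_] : exists s, i.+1 = (lr p + s)%N by exists (i.+1 - lr p)%N; lia.
rewrite is_ c_oddS; last lia.
have -> : (lr p + s).-1 = i by lia.
rewrite mulf_neq0 ?IH //; first lia.
have hm : odd_range (lm p s) k.
  by rewrite /lm; have -> : (lu p - s = lr p + lu p - i.+1)%N by lia.
by rewrite mulf_neq0 ?invr_eq0 ?lt0r_neq0 ?prd_num ?prd_den //; lia.
Qed.

Lemma update_diag (s : nat) (k : int) :
  update_mx p Y s k k = - (c_even p Y (s - 1) k / c_odd p Y (lr p + s - 1) k)
    * ((Y (upd_B p s k) - Y (upd_A p s k)) / (Y (upd_D p s k) - Y (upd_A p s k))).
Proof. by rewrite /update_mx eqxx. Qed.

Lemma update_sub (s : nat) (k : int) :
  update_mx p Y s k (k - 1) =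
    - (c_even p Y (s - 1) k / c_odd p Y (lr p + s - 1) (k - 1))
    * ((Y (upd_D p s k) - Y (upd_C p s k)) / (Y (upd_D p s k) - Y (upd_A p s k))).
Proof.
rewrite /update_mx eqxx; have -> : (k - 1 == k) = false by lia.
by [].
Qed.

Lemma predict_diag (s : nat) (k : int) :
  predict_mx p Y s k k = c_odd p Y (lr p + s - 1) k / c_even p Y s k
    * ((Y (prd_D p s k) - Y (prd_C p s k)) / (Y (prd_D p s k) - Y (prd_A p s k))).
Proof. by rewrite /predict_mx eqxx. Qed.

Lemma predict_sup (s : nat) (k : int) :
  predict_mx p Y s k (k + 1) = c_odd p Y (lr p + s - 1) k / c_even p Y s (k + 1)
    * ((Y (prd_B p s k) - Y (prd_A p s k)) / (Y (prd_D p s k) - Y (prd_A p s k))).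
Proof.
rewrite /predict_mx eqxx; have -> : (k + 1 == k) = false by lia.
by [].
Qed.

(** The factors [c] are made so that they cancel, which reduces a step to an exchange identity
    between the old even value [v0], the left and right odd values [v1], [v2] and the new value
    [v]. *)
Lemma update_exchange (s : nat) (k : int) (e o : int -> R) (v v0 v1 v2 : R) :
  (1 <= s <= lu p)%N -> even_range (lm p s) k ->
  (Y (upd_C p s k) - Y (upd_B p s k)) * v
    = (Y (upd_D p s k) - Y (upd_A p s k)) * v0
      - (Y (upd_B p s k) - Y (upd_A p s k)) * v2
      - (Y (upd_D p s k) - Y (upd_C p s k)) * v1 ->
  e k = c_even p Y (s - 1) k * v0 ->
  o (k - 1) = c_odd p Y (lr p + s - 1) (k - 1) * v1 ->
  o k = c_odd p Y (lr p + s - 1) k * v2 ->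
  e k + apply_update p Y s o k = c_even p Y s k * v.
Proof.
move=> hs hk hv -> o1 o2; rewrite /apply_update update_diag update_sub o1 o2.
have d0 := lt0r_neq0 (upd_den hs hk).
have -> : c_even p Y s k = c_even p Y (s - 1) k *
    ((Y (upd_C p s k) - Y (upd_B p s k)) / (Y (upd_D p s k) - Y (upd_A p s k))).
  by have := c_evenS (s - 1) k; have -> : (s - 1).+1 = s by lia.
have n1 : c_odd p Y (lr p + s - 1) (k - 1) != 0.
  by apply: c_odd_neq0; [lia | move: hk; rewrite /even_range /odd_range /lm; lia].
have n2 : c_odd p Y (lr p + s - 1) k != 0.
  by apply: c_odd_neq0; [lia | move: hk; rewrite /even_range /odd_range /lm; lia].
transitivity (c_even p Y (s - 1) k * ((Y (upd_C p s k) - Y (upd_B p s k)) * v)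
    / (Y (upd_D p s k) - Y (upd_A p s k))); last by ring.
by rewrite hv; field; rewrite d0 n1 n2.
Qed.

(** The new odd factor is never divided by, so the last prediction, where it vanishes, is
    covered. *)
Lemma predict_exchange (s : nat) (k : int) (e o : int -> R) (v v0 v1 v2 : R) :
  (1 <= lr p + s)%N -> (s <= lu p)%N -> odd_range (lm p s) k ->
  (Y (prd_C p s k) - Y (prd_B p s k)) * v
    = (Y (prd_D p s k) - Y (prd_A p s k)) * v0
      - (Y (prd_B p s k) - Y (prd_A p s k)) * v2
      - (Y (prd_D p s k) - Y (prd_C p s k)) * v1 ->
  o k = c_odd p Y (lr p + s - 1) k * v0 ->
  e k = c_even p Y s k * v1 ->
  e (k + 1) = c_even p Y s (k + 1) * v2 ->
  o k - apply_predict p Y s e k = c_odd p Y (lr p + s) k * v.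
Proof.
move=> hs hsu hk hv -> e1 e2; rewrite /apply_predict predict_diag predict_sup e1 e2.
have d0 := lt0r_neq0 (prd_den hs hk).
rewrite c_oddS // -subn1.
have n1 : c_even p Y s k != 0.
  by apply: c_even_neq0 => //; move: hk; rewrite /even_range /odd_range; lia.
have n2 : c_even p Y s (k + 1) != 0.
  by apply: c_even_neq0 => //; move: hk; rewrite /even_range /odd_range; lia.
transitivity (c_odd p Y (lr p + s - 1) k * ((Y (prd_C p s k) - Y (prd_B p s k)) * v)
    / (Y (prd_D p s k) - Y (prd_A p s k))); last by ring.
by rewrite hv; field; rewrite d0 n1 n2.
Qed.

End Factors.

(** * Forward transform of the power coefficients *)

Lemma consec_split (b b1 b2 : int) (N N1 N2 : nat) :
  (b1 = b /\ b2 = b + 1 /\ N1 = uphalf N /\ N2 = N./2)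
  \/ (b2 = b /\ b1 = b + 1 /\ N2 = uphalf N /\ N1 = N./2) ->
  perm_eq (consec b N) (prog b1 N1 ++ prog b2 N2).
Proof.
case=> -[-> [-> [-> ->]]]; first exact: consec_prog.
by apply: perm_trans (consec_prog _ _) _; rewrite perm_catC.
Qed.

Section Forward.
Variables (R : realType) (p : nat) (Y : int -> R) (w : int) (d : nat) (cst : R).
Hypothesis p_gt0 : (1 <= p)%N.
Hypothesis Ystrict : forall i j, i < j -> 0 < j -> i < w -> Y i < Y j.

Local Notation u := (lu p).
Local Notation r := (lr p).
Local Notation rho := (nat_of_bool (odd p)).

(** For [d = p.-1 - q] and [cst] the binomial coefficient, this is the symmetric mean over [K]. *)
Definition pcoef (K : seq int) : R := (knot_poly Y K)`_d / cst.

Lemma pcoef_perm (K K' : seq int) : perm_eq K K' -> pcoef K = pcoef K'.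
Proof. by move=> h; rewrite /pcoef (knot_poly_perm _ h). Qed.

Lemma pcoef4 (A B C D : int) (F : seq int) :
  (Y C - Y B) * pcoef [:: A, D & F] = (Y D - Y A) * pcoef [:: B, C & F]
    - (Y B - Y A) * pcoef [:: C, D & F] - (Y D - Y C) * pcoef [:: A, B & F].
Proof. by rewrite /pcoef !mulrA knot_poly4; ring. Qed.

Lemma pcoef3 (A C D : int) (F : seq int) :
  (Y C - Y A) * pcoef (D :: F)
    = (Y D - Y A) * pcoef (C :: F) - (Y D - Y C) * pcoef (A :: F).
Proof. by rewrite /pcoef !mulrA knot_poly3; ring. Qed.

(** The invariants after step [s]: each step widens the window of even-indexed knots by one position
    on each side and narrows that of the odd-indexed ones. *)
Definition even_coefs (s : nat) (e : int -> R) : Prop :=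
  forall k, even_range w (u - s) k ->
    e k = c_even p Y s k * pcoef (eset rho (u + r + s).-1 (u - s) k).

Definition odd_coefs (s : nat) (o : int -> R) : Prop :=
  forall k, odd_range w (u - s) k ->
    o k = c_odd p Y (r + s) k * pcoef (oset rho (u + r + s) (u - s) k).

(** The four knot exchange. The second condition excludes the first step for odd [p]; beyond it
    [lutilde] is twice the parity of [p]. *)
Lemma update_regular (s : nat) (e o : int -> R) : (s < u)%N ->
  (1 <= r + s)%N || ~~ odd p -> even_coefs s e -> odd_coefs s o ->
  even_coefs s.+1 (fun k => e k + apply_update p Y s.+1 o k).
Proof.
move=> hs hrs he ho k hk; have hrho : (rho <= 1)%N by case: odd.
have [h1 h2 h3 h4 _] := @eset_exchange rho (u + r + s).-1 (u - s.+1) k hrho.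
have ea : (u + r + s.+1).-1 = (u + r + s).-1.+1 by lia.
have ea' : (u + r + s)%N = (u + r + s).-1.+1 by lia.
have em : (u - s)%N = (u - s.+1).+1 by lia.
have eA : upd_A p s.+1 k = 2 * k - 2 * (u + r + s).-1%:Z - 2 + 2 * rho%:Z.
  rewrite /upd_A lm_subn lt_subn; suff -> : lutilde p s.+1 = (2 * rho)%N by lia.
  case/orP: hrs => [h|/negbTE op]; first by apply: lutilde_reg; lia.
  by rewrite /lutilde op.
have eB : upd_B p s.+1 k = 2 * k - 2 * (u - s.+1)%:Z - 1 by [].
have eC : upd_C p s.+1 k = 2 * k + 2 * (u - s.+1)%:Z + 1 by [].
have eD : upd_D p s.+1 k = 2 * k + 2 * (u + r + s).-1%:Z + 2.
  by rewrite /upd_D lm_subn lt_subn; lia.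
cbn beta.
apply: (update_exchange Ystrict (v := pcoef (eset rho (u + r + s.+1).-1 (u - s.+1) k))
  (v0 := pcoef (eset rho (u + r + s).-1 (u - s) k))
  (v1 := pcoef (oset rho (u + r + s) (u - s) (k - 1)))
  (v2 := pcoef (oset rho (u + r + s) (u - s) k))).
- by lia.
- by [].
- rewrite ea em ea' (pcoef_perm h1) (pcoef_perm h2) (pcoef_perm h3) (pcoef_perm h4).
  by rewrite eA eB eC eD; apply: pcoef4.
- by rewrite subn1; apply: he; apply: even_range_le hk; lia.
- rewrite addnS subn1; apply: ho.
  by move: hk; rewrite /even_range /odd_range; lia.
- rewrite addnS subn1; apply: ho.
  by move: hk; rewrite /even_range /odd_range; lia.
Qed.

(** The condition on [o] is the invariant of the preceding step written out, so that [s = 0], which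
    has no predecessor, is included. *)
Lemma predict_regular (s : nat) (e o : int -> R) : (s <= u)%N ->
  (1 <= r + s)%N -> (1 <= s)%N \/ ~~ odd p ->
  even_coefs s e ->
  (forall k, odd_range w (u - s) k ->
    o k = c_odd p Y (r + s - 1) k
          * pcoef (oset rho (u + r + s).-1 (u - s).+1 k)) ->
  odd_coefs s (fun k => o k - apply_predict p Y s e k).
Proof.
move=> hs hrs hso he ho k hk; have hrho : (rho <= 1)%N by case: odd.
have hr := lr_le1 p.
set a := (u + r + s).-1 in he ho *; set m := (u - s)%N in he ho hk *.
have ea : (u + r + s = a.+1)%N by rewrite /a; lia.
have ett : lttilde p s = (2 * rho)%N.
  case: hso => [/lttilde_reg //|]; case: s {he ho hs hrs a ea m hk} => [|s] op.
    by rewrite lttilde0; move: op; case: odd.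
  by rewrite lttilde_reg.
have eA : prd_A p s k = 2 * k - 2 * a%:Z + 2 * rho%:Z.
  by rewrite /prd_A lm_subn lt_subn ett; lia.
have eB : prd_B p s k = 2 * k - 2 * m%:Z + 1 by [].
have eC : prd_C p s k = 2 * k + 2 * m%:Z + 1 by [].
have eD : prd_D p s k = 2 * k + 2 * a%:Z + 2.
  by rewrite /prd_D lm_subn lt_subn; lia.
have hra : (rho <= 2 * a)%N by rewrite /a; case: hso; case: odd => //=; lia.
cbn beta; rewrite ea.
apply: (predict_exchange (w := w) Ystrict (v := pcoef (oset rho a.+1 m k))
  (v0 := pcoef (oset rho a m.+1 k))
  (v1 := pcoef (eset rho a m k)) (v2 := pcoef (eset rho a m (k + 1)))) => //.
- case m0: m => [|m']; last first.
    have [h1 h2 h3 h4 _] := @oset_exchange rho a m'.+1 k hrho hra isT.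
    rewrite (pcoef_perm h1) (pcoef_perm h2) (pcoef_perm h3) (pcoef_perm h4).
    by rewrite eA eB eC eD m0; apply: pcoef4.
  (* For [s = u] the left side is zero, whatever the new value is. The old odd set has the single
     odd index [C], and the rest is the three knot identity. *)
  have eBC : prd_B p s k = prd_C p s k by rewrite eB eC m0; lia.
  rewrite /oset /eset eBC subrr mul0r.
  have -> : (2 * a + 1 - rho = (2 * a - rho).+1)%N by lia.
  have -> : 2 * (k + 1) - 2 * a%:Z + 2 * rho%:Z = prd_A p s k + 2 by rewrite eA; lia.
  have -> : 2 * k - 2 * a%:Z + 2 + 2 * rho%:Z = prd_A p s k + 2 by rewrite eA; lia.
  rewrite -eA !cats0 (progS (prd_A p s k)) (progSr (prd_A p s k + 2)).
  have -> : 2 * k - 2 * 1%:Z + 3 = prd_C p s k by rewrite eC m0; lia.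
  have -> : prd_A p s k + 2 + 2 * (2 * a - rho)%N%:Z = prd_D p s k.
    by rewrite eA eD; lia.
  have -> : prog (prd_C p s k) (2 * 1 - 1) = [:: prd_C p s k] by rewrite progS.
  set F := prog (prd_A p s k + 2) (2 * a - rho).
  rewrite (pcoef_perm (K := _ ++ [:: _]) (K' := prd_C p s k :: F)); last first.
    by rewrite perm_catC.
  rewrite (pcoef_perm (K := rcons _ _) (K' := prd_D p s k :: F)); last first.
    by rewrite perm_rcons.
  by have := pcoef3 (prd_A p s k) (prd_C p s k) (prd_D p s k) F; lra.
- exact: ho.
- by apply: he; move: hk; rewrite /even_range /odd_range; lia.
- by apply: he; move: hk; rewrite /even_range /odd_range; lia.
Qed.

Definition forward_state (s : nat) (eo : (int -> R) * (int -> R)) : Prop :=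
  even_coefs s eo.1 /\ odd_coefs s eo.2.

Lemma lift_step_state (s : nat) (eo : (int -> R) * (int -> R)) :
  (s < u)%N -> (1 <= r + s)%N || ~~ odd p ->
  forward_state s eo -> forward_state s.+1 (lift_step p Y eo s.+1).
Proof.
case: eo => e o hs hrs [/= he ho].
have he' := update_regular hs hrs he ho.
split=> //=; apply: predict_regular => //; [by lia | by left |].
move=> k hk; rewrite addnS subn1 ho.
  have -> : (u - s = (u - s.+1).+1)%N by lia.
  by have -> : (u + r + s.+1).-1 = (u + r + s)%N by lia.
by apply: odd_range_le hk; lia.
Qed.

Lemma lift_steps_state (l s : nat) (eo : (int -> R) * (int -> R)) :
  (s + l <= u)%N -> (1 <= r + s)%N || ~~ odd p -> forward_state s eo ->
  forward_state (s + l) (foldl (lift_step p Y) eo (iota s.+1 l)).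
Proof.
elim: l s eo => [|l IH] s eo hsl hrs hst; first by rewrite addn0.
by rewrite /= addnS -addSn; apply: IH; [lia | lia | apply: lift_step_state => //; lia].
Qed.

Definition inner_coef (b : int) : R := pcoef (consec (b - (p./2)%:Z + 1) p.-1).

(** Only the entry into the induction depends on the parity of [p] and on [r]. For even [p] the
    initial knot sets already fit the invariants; for odd [p] the first step is a three knot
    exchange, treated by hand. *)
Lemma state_init : forward_state u (foldl (lift_step p Y)
  (fun k => inner_coef (2 * k), fun k => inner_coef (2 * k + 1)) (lift_indices p)).
Proof.
have hr := lr_le1 p; have hpE := lu_lr p.
case op : (odd p); rewrite op in hpE; case r0: r hr hpE => [|[|//]] _ hpE;
  rewrite /lift_indices r0 ?addn0 ?addn1 ?subn0 ?subnn.
(* [p = 4u - 1]: the first update has [A = B]. With the common part [G], it exchanges [C] for [D],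
   and [A] belongs to the left odd neighbour. *)
- have hu : u = u.-1.+1 by lia.
  rewrite hu [iota _ _]/= [foldl _ _ _]/=.
  have -> : u.-1.+1 = (1 + u.-1)%N by lia.
  apply: lift_steps_state; [lia | lia | ].
  have he : even_coefs 1 (fun k => inner_coef (2 * k)
      + apply_update p Y 1 (fun k => inner_coef (2 * k + 1)) k).
    move=> k hk.
    pose G := prog (2 * k - 2 * u%:Z + 2) (2 * u - 1) ++ prog (2 * k - 2 * u%:Z + 3) (2 * u - 2).
    have eA : upd_A p 1 k = 2 * k - 2 * u%:Z + 1.
      by rewrite /upd_A lm_subn lt_subn lutilde1 ?r0 // op; lia.
    have eB : upd_B p 1 k = upd_A p 1 k by rewrite eA /upd_B lm_subn; lia.
    have eC : upd_C p 1 k = 2 * k + 2 * u%:Z - 1 by rewrite /upd_C lm_subn; lia.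
    have eD : upd_D p 1 k = 2 * k + 2 * u%:Z by rewrite /upd_D lm_subn lt_subn r0; lia.
    have hs1 : (1 <= 1 <= u)%N by lia.
    apply: (update_exchange Ystrict (s := 1) (e := fun k => inner_coef (2 * k))
      (o := fun k => inner_coef (2 * k + 1)) (v0 := inner_coef (2 * k))
      (v1 := inner_coef (2 * (k - 1) + 1)) (v2 := inner_coef (2 * k + 1)) hs1 hk).
    + rewrite eB subrr mul0r subr0 /inner_coef r0 /eset op.
      rewrite (pcoef_perm (K' := upd_D p 1 k :: G)); last first.
        have -> : (2 * (u + 0 + 1).-1 + 1 - true = (2 * u - 1).+1)%N by lia.
        have -> : 2 * k - 2 * (u + 0 + 1).-1%:Z + 2 * true%:Z = 2 * k - 2 * u%:Z + 2 by lia.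
        have -> : 2 * k - 2 * (u - 1)%:Z + 1 = 2 * k - 2 * u%:Z + 3 by lia.
        have -> : (2 * (u - 1) = 2 * u - 2)%N by lia.
        rewrite progSr eD.
        have -> : 2 * k - 2 * u%:Z + 2 + 2 * (2 * u - 1)%N%:Z = 2 * k + 2 * u%:Z by lia.
        by rewrite cat_rcons perm_sym -cat1s perm_catCA.
      rewrite (pcoef_perm (K := consec (2 * k - _ + 1) _) (K' := upd_C p 1 k :: G)); last first.
        apply: (perm_trans (y := prog (2 * k - 2 * u%:Z + 2) (2 * u - 1)
                                 ++ prog (2 * k - 2 * u%:Z + 3) (2 * u - 2).+1)).
          by apply: consec_split; lia.
        rewrite progSr eC.
        have -> : 2 * k - 2 * u%:Z + 3 + 2 * (2 * u - 2)%N%:Z = 2 * k + 2 * u%:Z - 1 by lia.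
        by rewrite -rcons_cat perm_rcons.
      rewrite (pcoef_perm (K := consec (2 * (k - 1) + 1 - _ + 1) _)
        (K' := upd_A p 1 k :: G)); last first.
        apply: (perm_trans (y := prog (2 * k - 2 * u%:Z + 2) (2 * u - 1)
                                 ++ prog (2 * k - 2 * u%:Z + 1) (2 * u - 2).+1)).
          by apply: consec_split; lia.
        rewrite progS eA.
        have -> : 2 * k - 2 * u%:Z + 1 + 2 = 2 * k - 2 * u%:Z + 3 by lia.
        by rewrite -cat1s perm_catCA.
      exact: pcoef3.
    + by rewrite subnn mul1r.
    + by rewrite r0 mul1r.
    + by rewrite r0 mul1r.
  split=> //=; apply: predict_regular => //; [by lia | by lia | by left |].
  move=> k hk; rewrite r0 mul1r /inner_coef; apply: pcoef_perm; rewrite op.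
  rewrite /oset; apply: consec_split; lia.
(* [p = 4u + 1]: the first step is the prediction at [s = 0], again with [A = B]. *)
- have hG k : perm_eq (consec (2 * k - (p./2)%:Z + 1) p.-1)
      (prog (2 * k - 2 * u%:Z + 2) (2 * u) ++ prog (2 * k - 2 * u%:Z + 1) (2 * u)).
    by apply: consec_split; lia.
  rewrite [iota _ _]/= [foldl _ _ _]/=; apply: (@lift_steps_state u 0); [by [] | lia | split].
    move=> k _; rewrite mul1r /inner_coef; apply: pcoef_perm; apply: perm_trans (hG k) _.
    rewrite /eset op r0; apply/permP => P; congr (count P (prog _ _ ++ prog _ _)); lia.
  move=> k; rewrite subn0 => hk.
  have eA : prd_A p 0 k = 2 * k - 2 * u%:Z + 1.
    by rewrite /prd_A lm_subn lt_subn lttilde0 op; lia.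
  have eB : prd_B p 0 k = prd_A p 0 k by rewrite eA /prd_B lm_subn; lia.
  have eC : prd_C p 0 k = 2 * k + 2 * u%:Z + 1 by rewrite /prd_C lm_subn; lia.
  have eD : prd_D p 0 k = 2 * k + 2 * u%:Z + 2.
    by rewrite /prd_D lm_subn lt_subn r0; lia.
  have hs0 : (1 <= r + 0)%N by rewrite r0.
  apply: (predict_exchange (w := w) Ystrict (s := 0) (o := fun k => inner_coef (2 * k + 1))
    (e := fun k => inner_coef (2 * k)) (v0 := inner_coef (2 * k + 1))
    (v1 := inner_coef (2 * k)) (v2 := inner_coef (2 * (k + 1))) hs0) => //.
  + by rewrite /lm subn0.
  + rewrite eB subrr mul0r subr0 /inner_coef.
    (* For [p = 1] the knot sets are empty and [A = C]. *)
    case u0 : u => [|u'].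
      have -> : p.-1 = 0%N by lia.
      have -> : prd_C p 0 k = prd_A p 0 k by lia.
      by rewrite subrr; ring.
    rewrite -u0 r0 /oset op.
    pose G := prog (2 * k - 2 * u%:Z + 2) (2 * u) ++ prog (2 * k - 2 * u%:Z + 3) (2 * u - 1).
    rewrite (pcoef_perm (K' := prd_D p 0 k :: G)); last first.
      have -> : (2 * (u + 1 + 0) - true = (2 * u).+1)%N by lia.
      have -> : 2 * k - 2 * (u + 1 + 0)%N%:Z + 2 + 2 * true%:Z = 2 * k - 2 * u%:Z + 2 by lia.
      rewrite progSr eD.
      have -> : 2 * k - 2 * u%:Z + 2 + 2 * (2 * u)%N%:Z = 2 * k + 2 * u%:Z + 2 by lia.
      by rewrite cat_rcons perm_sym -cat1s perm_catCA.
    rewrite (pcoef_perm (K := consec (2 * k + 1 - _ + 1) _) (K' := prd_C p 0 k :: G)); last first.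
      apply: (perm_trans (y := prog (2 * k - 2 * u%:Z + 2) (2 * u)
                               ++ prog (2 * k - 2 * u%:Z + 3) (2 * u - 1).+1)).
        by apply: consec_split; lia.
      rewrite progSr eC.
      have -> : 2 * k - 2 * u%:Z + 3 + 2 * (2 * u - 1)%N%:Z = 2 * k + 2 * u%:Z + 1 by lia.
      by rewrite -rcons_cat perm_rcons.
    rewrite (pcoef_perm (K := consec (2 * k - _ + 1) _) (K' := prd_A p 0 k :: G)); last first.
      apply: (perm_trans (hG k)).
      have -> : prog (2 * k - 2 * u%:Z + 1) (2 * u)
              = prd_A p 0 k :: prog (2 * k - 2 * u%:Z + 3) (2 * u - 1).
        have -> : (2 * u = (2 * u - 1).+1)%N by lia.
        by rewrite progS eA subn1; congr (_ :: prog _ _); lia.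
      by rewrite -cat1s perm_catCA.
    exact: pcoef3.
  + by rewrite r0 mul1r.
  + by rewrite mul1r.
  + by rewrite mul1r.
(* [p = 4u]: the invariants hold before any step. *)
- apply: (@lift_steps_state u 0); [by [] | by rewrite op orbT | split => k hk].
    rewrite mul1r /inner_coef; apply: pcoef_perm; rewrite /eset op r0.
    by apply: consec_split; lia.
  rewrite r0 mul1r /inner_coef; apply: pcoef_perm; rewrite /oset op.
  by apply: consec_split; lia.
(* [p = 4u + 2]: a regular prediction at [s = 0] comes first. *)
- rewrite [iota _ _]/= [foldl _ _ _]/=.
  apply: (@lift_steps_state u 0); [by [] | by rewrite op orbT |].
  have he : even_coefs 0 (fun k => inner_coef (2 * k)).
    move=> k hk; rewrite mul1r /inner_coef; apply: pcoef_perm; rewrite /eset op r0.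
    by apply: consec_split; lia.
  split=> //; apply: predict_regular => //; [by rewrite r0 | by right; rewrite op |].
  move=> k hk; rewrite r0 mul1r /inner_coef; apply: pcoef_perm; rewrite /oset op.
  by apply: consec_split; lia.
Qed.

End Forward.

(** * Monotonicity of knots with multiple end points *)

Section KnotMono.
Variables (R : realType) (n : nat) (x : nat -> R).
Hypothesis x_incr : forall k, (k.+1 < n)%N -> x k < x k.+1.

Lemma grid_lt (i j : nat) : (i < j)%N -> (j < n)%N -> x i < x j.
Proof.
elim: j => [//|j IH] hij hj; move: hij; rewrite ltnS leq_eqVlt => /predU1P[->|hij].
  exact: x_incr.
by apply: lt_trans (IH hij _) (x_incr hj); lia.
Qed.

Lemma knot_lt (i j : int) : (1 < n)%N ->
  i < j -> 0 < j -> i < n%:Z - 1 -> knot n x i < knot n x j.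
Proof.
case: i => i; case: j => j // n0 ij j0 iw; rewrite /knot; apply: grid_lt; lia.
Qed.

Lemma knot_le (i j : int) : (0 < n)%N -> i <= j -> knot n x i <= knot n x j.
Proof.
move=> n0; rewrite le_eqVlt => /predU1P[-> //|ij].
case: (lerP j 0) => hj.
  case: i ij => i ij; case: j ij hj => j ij hj //=; try lia.
  have -> : j = 0%N by lia.
  by rewrite min0n.
case: (leqP n 1) => n1.
  have x0 k : knot n x k = x 0%N by case: k => k //=; congr x; lia.
  by rewrite !x0.
case: (ltP i (n%:Z - 1)) => hi; first by rewrite ltW // knot_lt.
case: i ij hi => i ij hi; last by lia.
case: j ij hj => j ij hj; last by lia.
by rewrite /knot !(minn_idPr _) //; lia.
Qed.

End KnotMono.

Section Reproduction.
Variables (R : realType) (p : nat) (Y : int -> R) (w : int) (d : nat) (cst : R).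
Hypothesis p_gt0 : (1 <= p)%N.
Hypothesis Ystrict : forall i j, i < j -> 0 < j -> i < w -> Y i < Y j.

Lemma lifting_detail (k : int) : 0 <= k -> 2 * k + 2 <= w ->
  (lifting p Y (inner_coef p Y d cst)).2 k = 0.
Proof.
move=> k0 kw; rewrite /lifting.
have := state_init d cst p_gt0 Ystrict; case: (foldl _ _ _) => e o [/= _ ho].
rewrite ho; last by rewrite /odd_range subnn; lia.
have hr := lr_le1 p; have hpE := lu_lr p.
rewrite c_oddS; last by lia.
have -> : prd_B p (lu p) k = prd_C p (lu p) k by rewrite /prd_B /prd_C lm_subn; lia.
by rewrite subrr mul0r mulr0 mul0r.
Qed.

(** At [s = u] the even set consists of doubled indices only, and rescaling removes the factor [c].
    The largest of the [p - 1] coarse indices is [k + ceil(p/2) - 1], whence the extent of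
    nesting. *)
Lemma lifting_coarse (X : int -> R) (k : int) :
  nested_upto X Y (k + (uphalf p)%:Z - 1) -> 0 <= k -> 2 * k <= w ->
  (lifting p Y (inner_coef p Y d cst)).1 k = inner_coef p X d cst k.
Proof.
move=> hXY k0 kw; rewrite /lifting.
have := state_init d cst p_gt0 Ystrict; case: (foldl _ _ _) => e o [/= he _].
have hr := lr_le1 p; have hpE := lu_lr p.
have hk : even_range w (lu p - lu p) k by rewrite /even_range subnn; lia.
rewrite he // /rescale_mx mulKf; last by apply: (c_even_neq0 Ystrict); rewrite ?leqnn.
rewrite /inner_coef /pcoef; congr ((polyseq _)`_ _ / _).
rewrite /eset subnn cats0 /knot_poly /prog /consec !big_map.
have -> : (2 * (lu p + lr p + lu p).-1 + 1 - odd p = p.-1)%N by lia.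
rewrite !big_seq; apply: eq_bigr => i; rewrite mem_iota => hi.
congr ('X + _%:P); rewrite -hXY; last by lia.
by congr (Y _); lia.
Qed.

End Reproduction.

Lemma lifting_power_coefs (R : realType) (p q n n' : nat) (X Y : int -> R)
    (w : int) (a b : int -> R) :
  (q < p)%N ->
  (forall i j, i <= j -> X i <= X j) -> (forall i j, i <= j -> Y i <= Y j) ->
  (forall i j, i < j -> 0 < j -> i < w -> Y i < Y j) ->
  power_coefs p q n' Y a -> power_coefs p q n X b ->
  (forall k, nested_upto X Y (k + (uphalf p)%:Z - 1) -> 0 <= k -> 2 * k <= w ->
     (lifting p Y a).1 k = b k) /\
  (forall k, 0 <= k -> 2 * k + 2 <= w -> (lifting p Y a).2 k = 0).
Proof.
move=> hq Xmono Ymono Ystrict ha hb.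
have E (Z : int -> R) c m : (forall i j, i <= j -> Z i <= Z j) -> power_coefs p q m Z c ->
    c = inner_coef p Z (p.-1 - q) ('C(p.-1, q))%:R.
  move=> Zmono hc; apply/funext => k.
  by rewrite (power_coefs_unique Zmono hq hc) knot_esym_meanE //; lia.
rewrite (E Y a n' Ymono ha) (E X b n Xmono hb).
split=> k; [apply: lifting_coarse => //|apply: lifting_detail => //]; by lia.
Qed.

(** * Inverse transform of delta sequences *)

Section Dual.
Variables (R : realType) (p : nat) (Y : int -> R).

Definition pair_seq : Type := ((int -> R) * (int -> R))%type.

Definition linear_form (T : pair_seq -> R) : Prop :=
  forall (c : R) (a b : pair_seq),
    T (fun k => c * a.1 k + b.1 k, fun k => c * a.2 k + b.2 k) = c * T a + T b.

Definition even_delta (i : int) : pair_seq := (fun k => (k == i)%:R, fun => 0).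
Definition odd_delta (i : int) : pair_seq := (fun => 0, fun k => (k == i)%:R).

(** Transposition: a form is precomposed with one inverse step. The last lifting step is undone
    first, so the forms are built in increasing order of [s]. *)
Definition undo_update (s : nat) (T : pair_seq -> R) (eo : pair_seq) : R :=
  T (fun k => eo.1 k - apply_update p Y s eo.2 k, eo.2).
Definition undo_predict (s : nat) (T : pair_seq -> R) (eo : pair_seq) : R :=
  T (eo.1, fun k => eo.2 k + apply_predict p Y s eo.1 k).

Lemma undo_updateP (s : nat) (T : pair_seq -> R) :
  linear_form T -> linear_form (undo_update s T).
Proof.
move=> hT c a b; rewrite /undo_update -hT /=; congr (T (_, _)).
by apply/funext => k; rewrite /apply_update; ring.
Qed.

Lemma undo_predictP (s : nat) (T : pair_seq -> R) :
  linear_form T -> linear_form (undo_predict s T).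
Proof.
move=> hT c a b; rewrite /undo_predict -hT /=; congr (T (_, _)).
by apply/funext => k; rewrite /apply_predict; ring.
Qed.

Lemma undo_update_even (s : nat) (T : pair_seq -> R) (i : int) :
  undo_update s T (even_delta i) = T (even_delta i).
Proof.
rewrite /undo_update /=; congr (T (_, _)).
by apply/funext => k; rewrite /apply_update; ring.
Qed.

(** Column [i] of the lower bidiagonal update matrix has its entries in rows [i] and [i + 1]. *)
Lemma undo_update_odd (s : nat) (T : pair_seq -> R) (i : int) : linear_form T ->
  undo_update s T (odd_delta i) = T (odd_delta i)
    - update_mx p Y s i i * T (even_delta i)
    - update_mx p Y s (i + 1) i * T (even_delta (i + 1)).
Proof.
move=> hT; transitivity (- update_mx p Y s (i + 1) i * T (even_delta (i + 1))
  + (- update_mx p Y s i i * T (even_delta i) + T (odd_delta i))); last by ring.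
rewrite -!hT /undo_update /=; congr (T (_, _)); last first.
  by apply/funext => k; ring.
apply/funext => k; rewrite /apply_update.
case: (eqVneq k i) => [->|ki].
  have -> : (i - 1 == i) = false by lia.
  have -> : (i == i + 1) = false by lia.
  by rewrite /=; ring.
case: (eqVneq k (i + 1)) => [->|ki1].
  by rewrite addrK eqxx /=; ring.
have -> : (k - 1 == i) = false by lia.
by rewrite /=; ring.
Qed.

Lemma undo_predict_odd (s : nat) (T : pair_seq -> R) (i : int) :
  undo_predict s T (odd_delta i) = T (odd_delta i).
Proof.
rewrite /undo_predict /=; congr (T (_, _)).
by apply/funext => k; rewrite /apply_predict; ring.
Qed.

Lemma undo_predict_even (s : nat) (T : pair_seq -> R) (i : int) : linear_form T ->
  undo_predict s T (even_delta i) = T (even_delta i)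
    + predict_mx p Y s i i * T (odd_delta i)
    + predict_mx p Y s (i - 1) i * T (odd_delta (i - 1)).
Proof.
move=> hT; transitivity (predict_mx p Y s (i - 1) i * T (odd_delta (i - 1))
  + (predict_mx p Y s i i * T (odd_delta i) + T (even_delta i))); last by ring.
rewrite -!hT /undo_predict /=; congr (T (_, _)).
  by apply/funext => k; ring.
apply/funext => k; rewrite /apply_predict.
case: (eqVneq k i) => [->|ki].
  have -> : (i + 1 == i) = false by lia.
  have -> : (i == i - 1) = false by lia.
  by rewrite /=; ring.
case: (eqVneq k (i - 1)) => [->|ki1].
  by rewrite subrK eqxx /=; ring.
have -> : (k + 1 == i) = false by lia.
by rewrite /=; ring.
Qed.

Lemma undo_stepS (s : nat) (T : pair_seq -> R) (eo : pair_seq) :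
  T (unlift_step p Y eo s.+1) = undo_predict s.+1 (undo_update s.+1 T) eo.
Proof. by case: eo. Qed.

Lemma undo_step0 (T : pair_seq -> R) (eo : pair_seq) :
  T (unlift_step p Y eo 0) = undo_predict 0 T eo.
Proof. by case: eo. Qed.

Definition undo_upto (T : pair_seq -> R) (s : nat) (eo : pair_seq) : R :=
  T (foldl (unlift_step p Y) eo (rev (iota (1 - lr p) (lr p + s)))).

Lemma undo_uptoS (T : pair_seq -> R) (s : nat) :
  undo_upto T s.+1 = undo_predict s.+1 (undo_update s.+1 (undo_upto T s)).
Proof.
have hr := lr_le1 p; apply/funext => eo; rewrite -undo_stepS /undo_upto.
suff -> : iota (1 - lr p) (lr p + s.+1) = rcons (iota (1 - lr p) (lr p + s)) s.+1.
  by rewrite rev_rcons.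
by rewrite addnS -(addn1 (lr p + s)) iotaD cats1; congr rcons; lia.
Qed.

Lemma undo_upto0 (T : pair_seq -> R) : undo_upto T 0 =
  if lr p == 0%N then T else undo_predict 0 T.
Proof.
have hr := lr_le1 p; apply/funext => eo; rewrite /undo_upto addn0.
case: (lr p) hr => [|[|]] //= _; exact: undo_step0.
Qed.

Lemma undo_uptoP (T : pair_seq -> R) (s : nat) :
  linear_form T -> linear_form (undo_upto T s).
Proof.
move=> hT; elim: s => [|s IH].
  by rewrite undo_upto0; case: ifP => // _; apply: undo_predictP.
by rewrite undo_uptoS; apply/undo_predictP/undo_updateP.
Qed.

(** The threshold is a fine index. It measures how far the band of the refinement matrix reaches. *)
Definition vanish_above (th : int) (T : pair_seq -> R) : Prop :=
  forall i, (th <= 2 * i -> T (even_delta i) = 0) /\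
            (th <= 2 * i + 1 -> T (odd_delta i) = 0).
Definition vanish_below (th : int) (T : pair_seq -> R) : Prop :=
  forall i, (2 * i <= th -> T (even_delta i) = 0) /\
            (2 * i + 1 <= th -> T (odd_delta i) = 0).

(** The diagonal entry couples the odd index [2i + 1] to the smaller index [2i], which costs one
    position unless all these entries vanish. *)
Lemma undo_update_above (s : nat) (T : pair_seq -> R) (th th' : int) :
  linear_form T -> th' = th + 1 \/ th' = th /\ (forall i, update_mx p Y s i i = 0) ->
  vanish_above th T -> vanish_above th' (undo_update s T).
Proof.
move=> hT hth v i; rewrite undo_update_even undo_update_odd //; split=> hi.
  by apply: (v i).1; case: hth => [|[]]; lia.
rewrite (v i).2; last by case: hth => [|[]]; lia.
rewrite (v (i + 1)).1; last by case: hth => [|[]]; lia.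
case: hth => [e|[e ->]]; last by rewrite !mul0r mulr0 !subr0.
by rewrite (v i).1 ?mulr0 ?subr0 //; lia.
Qed.

Lemma undo_predict_above (s : nat) (T : pair_seq -> R) (th th' : int) :
  linear_form T ->
  th' = th + 1 \/ th' = th /\ (forall i, predict_mx p Y s (i - 1) i = 0) ->
  vanish_above th T -> vanish_above th' (undo_predict s T).
Proof.
move=> hT hth v i; rewrite undo_predict_odd undo_predict_even //; split=> hi; last first.
  by apply: (v i).2; case: hth => [|[]]; lia.
rewrite (v i).1; last by case: hth => [|[]]; lia.
rewrite (v i).2; last by case: hth => [|[]]; lia.
case: hth => [e|[e ->]]; last by rewrite mul0r mulr0 !addr0.
by rewrite (v (i - 1)).2 ?mulr0 ?addr0 //; lia.
Qed.

Lemma undo_update_below (s : nat) (T : pair_seq -> R) (th : int) :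
  linear_form T -> vanish_below th T -> vanish_below (th - 1) (undo_update s T).
Proof.
move=> hT v i; rewrite undo_update_even undo_update_odd //; split=> hi.
  by apply: (v i).1; lia.
rewrite (v i).2; last by lia.
rewrite (v (i + 1)).1; last by lia.
by rewrite (v i).1 ?mulr0 ?subr0 //; lia.
Qed.

Lemma undo_predict_below (s : nat) (T : pair_seq -> R) (th : int) :
  linear_form T -> vanish_below th T -> vanish_below (th - 1) (undo_predict s T).
Proof.
move=> hT v i; rewrite undo_predict_odd undo_predict_even //; split=> hi; last first.
  by apply: (v i).2; lia.
rewrite (v i).1; last by lia.
rewrite (v i).2; last by lia.
by rewrite (v (i - 1)).2 ?mulr0 ?addr0 //; lia.
Qed.

Lemma undo_upto_below (T : pair_seq -> R) (th : int) (s : nat) : linear_form T ->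
  vanish_below th T -> vanish_below (th - (lr p + 2 * s)%N%:Z) (undo_upto T s).
Proof.
move=> hT v; have hr := lr_le1 p; elim: s => [|s IH].
  rewrite undo_upto0 muln0 addn0; case: eqP => [->|r1]; first by rewrite subr0.
  have -> : lr p = 1%N by lia.
  exact: undo_predict_below.
have hTs := undo_uptoP s hT.
rewrite undo_uptoS; have -> : th - (lr p + 2 * s.+1)%N%:Z = th - (lr p + 2 * s)%N%:Z - 1 - 1 by lia.
by apply: undo_predict_below; [exact: undo_updateP | exact: undo_update_below].
Qed.

(** Each of the [r + 2s] elementary steps costs one position, except the first one for odd [p]:
    there [A = B], so the entry reaching downwards is zero. *)
Lemma undo_upto_above (T : pair_seq -> R) (th : int) (s : nat) : linear_form T ->
  (1 <= lr p + s)%N ->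
  vanish_above th T ->
  vanish_above (th + (lr p + 2 * s)%N%:Z - (odd p)%:Z) (undo_upto T s).
Proof.
move=> hT hrs v; have hr := lr_le1 p.
(* The exceptional step is the prediction at [s = 0] if [r = 1], treated here, and the update at
   [s = 1] if [r = 0], treated in the induction. *)
have start : vanish_above (th + (lr p)%:Z - (odd p && (lr p == 1)%N)%:Z) (undo_upto T 0).
  rewrite undo_upto0; case: (eqVneq (lr p) 0%N) => [->|r1].
    by rewrite andbF subr0 addr0.
  have r1' : lr p = 1%N by lia.
  rewrite r1' eqxx andbT; apply: (undo_predict_above (th := th)) => //.
  case op: (odd p); [right; split; first by lia | left; lia].
  move=> i; rewrite -{2}(subrK 1 i) predict_sup /prd_A /prd_B lttilde0 lt_subn op r1' /=.
  set m := (lm p 0)%:Z.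
  have -> : 2 * (i - 1) - 2 * m - 2 * (1 + 2 * 0 - 1)%N%:Z + 1
    = 2 * (i - 1) - 2 * m + 1 by lia.
  by rewrite subrr mul0r mulr0.
elim: s hrs => [|s IH] hrs.
  have r1 : lr p = 1%N by lia.
  by move: start; rewrite r1 andbT muln0 addn0.
have hTs := undo_uptoP s hT; rewrite undo_uptoS.
apply: (undo_predict_above (th := th + (lr p + 2 * s)%N%:Z + 1 - (odd p)%:Z));
  [exact: undo_updateP | by left; lia |].
case: (posnP (lr p + s)%N) => [rs0|rs1]; last first.
  by apply: undo_update_above (IH rs1) => //; left; lia.
have r0 : lr p = 0%N by lia.
have s0 : s = 0%N by lia.
move: start; rewrite r0 s0 andbF subr0 addr0 => start.
rewrite s0 in hTs; apply: (undo_update_above hTs _ start).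
case op: (odd p); [right; split; first by lia | left; lia].
move=> i; rewrite update_diag /upd_A /upd_B lutilde1 ?r0 // lt_subn op r0 /=.
have -> : 2 * i - 2 * (lm p 1)%:Z - 2 * (0 + 2 * 1 - 1)%N%:Z + 1
  = 2 * i - 2 * (lm p 1)%:Z - 1 by lia.
by rewrite subrr mul0r mulr0.
Qed.

End Dual.

(** One transposed step: [e] is the factor [c] at the target, [n1] and [n2] are those at its
    neighbours, [d1] and [d2] are the knot differences of the neighbours; all but [e] cancel. *)
Lemma exchange_sum (F : fieldType) (e a b c n1 n2 d d1 d2 x y z t : F) :
  n1 != 0 -> n2 != 0 -> d1 != 0 -> d2 != 0 ->
  d * t = a * x + b * y + c * z ->
  a / e * x + n1 / e * (c / d1) * (d1 / n1 * z) + n2 / e * (b / d2) * (d2 / n2 * y)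
    = d / e * t.
Proof.
move=> h1 h2 h3 h4 h; rewrite [RHS]mulrAC h.
have -> : n1 / e * (c / d1) * (d1 / n1 * z) = (n1 / n1) * (d1 / d1) * (c * z / e) by ring.
have -> : n2 / e * (b / d2) * (d2 / n2 * y) = (n2 / n2) * (d2 / d2) * (b * y / e) by ring.
by rewrite !divff //; ring.
Qed.

Lemma div_swap (F : fieldType) (n d e : F) : n != 0 -> d / e = n / (e * (n / d)).
Proof.
move=> n0; rewrite !invfM invrK.
have -> : n * (e^-1 * (n^-1 * d)) = (n / n) * (d / e) by ring.
by rewrite divff // mul1r.
Qed.

Lemma exchange_sumN (F : fieldType) (e a b c n1 n2 d d1 d2 x y z t : F) :
  n1 != 0 -> n2 != 0 -> d1 != 0 -> d2 != 0 ->
  d * t = a * x + b * y + c * z ->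
  a / e * x - - (n1 / e) * (b / d1) * (d1 / n1 * y)
    - - (n2 / e) * (c / d2) * (d2 / n2 * z) = d / e * t.
Proof.
move=> h1 h2 h3 h4 h; rewrite [RHS]mulrAC h.
have -> : - (n1 / e) * (b / d1) * (d1 / n1 * y) = - ((n1 / n1) * (d1 / d1) * (b * y / e)) by ring.
have -> : - (n2 / e) * (c / d2) * (d2 / n2 * z) = - ((n2 / n2) * (d2 / d2) * (c * z / e)) by ring.
by rewrite !divff //; ring.
Qed.

(** * Invariants of the transposed steps *)

Section Backward.
Variables (R : realType) (p : nat) (Y : int -> R) (w : int) (g : R -> R).
Hypothesis Ystrict : forall i j, i < j -> 0 < j -> i < w -> Y i < Y j.

Local Notation u := (lu p).
Local Notation r := (lr p).
Local Notation rho := (nat_of_bool (odd p)).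
Local Notation dd := (ddiff Y g).

(** On such index sets the knots are distinct, so divided differences may be used. *)
Definition in_range (K : seq int) : bool := all (fun i => 0 <= i <= w) K.

Lemma in_range_inj (K : seq int) : uniq K -> in_range K -> injseq Y K.
Proof.
move=> hu /allP hK; split=> // i j /hK hi /hK hj e.
case: (ltgtP i j) => // ij; [have := Ystrict ij | have := Ystrict ij];
by rewrite e ltxx; lia.
Qed.

Lemma in_range_perm (K K' : seq int) : perm_eq K K' -> in_range K = in_range K'.
Proof. by move=> h; apply: perm_all. Qed.

(* The invariants of the transposed computation, T being the linear form that
   undoes the steps up to s and then sums the fine B-splines: the first two
   hold between the update and the prediction of step s, the others after it. *)
Definition even_upd (s : nat) (T : pair_seq R -> R) : Prop :=
  forall i, in_range (eset rho (u + r + s).-1 (u - s).+1 i) ->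
  T (even_delta R i) = (Y (upd_C p s i) - Y (upd_B p s i)) / c_even p Y s i
    * dd (eset rho (u + r + s).-1 (u - s).+1 i).

Definition odd_upd (s : nat) (T : pair_seq R -> R) : Prop :=
  forall i, in_range (oset rho (u + r + s) (u - s).+1 i) ->
  T (odd_delta R i) = (Y (prd_D p s i) - Y (prd_A p s i)) / c_odd p Y (r + s - 1) i
    * dd (oset rho (u + r + s) (u - s).+1 i).

Definition even_end (s : nat) (T : pair_seq R -> R) : Prop :=
  forall i, in_range (eset rho (u + r + s) (u - s) i) ->
  T (even_delta R i) =
    (Y (2 * i + 2 * (u + r + s)%N%:Z) - Y (2 * i - 2 * (u + r + s)%N%:Z + 2 * rho%:Z))
     / c_even p Y s i * dd (eset rho (u + r + s) (u - s) i).

Definition odd_end (s : nat) (T : pair_seq R -> R) : Prop :=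
  forall i, in_range (oset rho (u + r + s) (u - s).+1 i) ->
  T (odd_delta R i) = (Y (prd_C p s i) - Y (prd_B p s i)) / c_odd p Y (r + s) i
    * dd (oset rho (u + r + s) (u - s).+1 i).

(** [ddiff4] around [2i]: [[B,C,F]] is the even value, [[C,D,F]] and [[A,B,F]] come from the odd
    neighbours [2i + 1] and [2i - 1], and [[A,D,F]] is the result. *)
Lemma undo_predict_end (s : nat) (T : pair_seq R -> R) : linear_form T ->
  (s <= u)%N -> (1 <= r + s)%N -> (1 <= s)%N \/ ~~ odd p ->
  even_upd s T -> odd_upd s T -> even_end s (undo_predict p Y s T).
Proof.
move=> hT hs hrs hso he ho i; have hrho : (rho <= 1)%N by case: odd.
have hr := lr_le1 p.
set a := (u + r + s).-1 in he *; set m := (u - s)%N in he ho *.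
have ea : (u + r + s = a.+1)%N by rewrite /a; lia.
have ett : lttilde p s = (2 * rho)%N.
  case: hso => [/lttilde_reg //|]; case: s {he ho hs hrs a ea m} => [|s] op.
    by rewrite lttilde0; move: op; case: odd.
  by rewrite lttilde_reg.
rewrite /even_upd -/a -/m in he; rewrite /odd_upd ea -/m in ho; rewrite ea.
have [h1 h2 h3 h4 h5] := @eset_exchange rho a m i hrho.
set A := _ - 2 + _ in h1 h4 h5; set B := _ - 1 in h2 h4 h5.
set C := _ + 1 in h2 h3 h5; set D := _ + 2 in h1 h3 h5.
have -> : 2 * i + 2 * a.+1%:Z = D by rewrite /D; lia.
have -> : 2 * i - 2 * a.+1%:Z + 2 * rho%:Z = A by rewrite /A; lia.
have eA : prd_A p s (i - 1) = A by rewrite /prd_A /A lm_subn lt_subn ett; lia.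
have eB : prd_B p s (i - 1) = B by rewrite /prd_B /B lm_subn; lia.
have eC : prd_C p s i = C by [].
have eD : prd_D p s i = D by rewrite /prd_D /D lm_subn lt_subn; lia.
rewrite (in_range_perm h1) => /[dup] hK /= /and3P[hA hD hF].
(* [B] and [C] lie between [A] and [D], hence inside the grid as well. *)
have hB : 0 <= B <= w by move: hA hD; rewrite /A /B /D /m; lia.
have hC : 0 <= C <= w by move: hA hD; rewrite /A /C /D /m; lia.
have hi : 0 <= 2 * i - 2 /\ 2 * i + 2 <= w.
  by move: hA hD hso; rewrite /A /D /a; case: (odd p) => /=; lia.
have hra m' : [/\ even_range w m' i, odd_range w m' i & odd_range w m' (i - 1)].
  by case: hi => hi1 hi2; rewrite /even_range /odd_range; split; lia.
have nc : c_even p Y s i != 0.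
  by apply: (c_even_neq0 Ystrict hs); case: (hra (lm p s)).
have hrs' : (r + s - 1 < r + u)%N by lia.
have n1 : c_odd p Y (r + s - 1) i != 0.
  by apply: (c_odd_neq0 Ystrict hrs'); case: (hra (r + u - (r + s - 1))%N).
have n2 : c_odd p Y (r + s - 1) (i - 1) != 0.
  by apply: (c_odd_neq0 Ystrict hrs'); case: (hra (r + u - (r + s - 1))%N).
have d1 : Y D - Y (prd_A p s i) != 0.
  by rewrite -eD; apply/lt0r_neq0/(prd_den Ystrict hrs); case: (hra (lm p s)).
have d2 : Y (prd_D p s (i - 1)) - Y A != 0.
  by rewrite -eA; apply/lt0r_neq0/(prd_den Ystrict hrs); case: (hra (lm p s)).
have r5 : in_range [:: A, B, C, D & eset rho a m i].
  by rewrite /in_range /= hA hB hC hD.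
have inj5 : injseq Y [:: A, B, C, D & eset rho a m i].
  by apply: in_range_inj r5; rewrite -(perm_uniq h5) eset_uniq.
have he' : T (even_delta R i) = (Y C - Y B) / c_even p Y s i * dd [:: B, C & eset rho a m i].
  rewrite he; last by rewrite (in_range_perm h2) /in_range /= hB hC.
  by rewrite (ddiff_perm _ _ h2) /upd_C /upd_B lm_subn.
have ho1 : T (odd_delta R i) = (Y D - Y (prd_A p s i)) / c_odd p Y (r + s - 1) i
    * dd [:: C, D & eset rho a m i].
  rewrite ho; last by rewrite (in_range_perm h3) /in_range /= hC hD.
  by rewrite (ddiff_perm _ _ h3) eD.
have ho2 : T (odd_delta R (i - 1)) = (Y (prd_D p s (i - 1)) - Y A)
    / c_odd p Y (r + s - 1) (i - 1) * dd [:: A, B & eset rho a m i].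
  rewrite ho; last by rewrite (in_range_perm h4) /in_range /= hA hB.
  by rewrite (ddiff_perm _ _ h4) eA.
have := predict_sup p Y s (i - 1); rewrite subrK => hP.
rewrite undo_predict_even // he' ho1 ho2 predict_diag hP eA eB eC eD.
rewrite (ddiff_perm _ _ h1).
exact: exchange_sum (ddiff4 g inj5).
Qed.

(* [even_end] with the knots of the next update in the prefactor. For odd p and
   r = 0 this is the form that holds before the first step. *)
Definition even_pre (s : nat) (T : pair_seq R -> R) : Prop :=
  forall i, in_range (eset rho (u + r + s) (u - s) i) ->
  T (even_delta R i) = (Y (upd_D p s.+1 i) - Y (upd_A p s.+1 i))
    / c_even p Y s i * dd (eset rho (u + r + s) (u - s) i).

Lemma even_end_pre (s : nat) (T : pair_seq R -> R) : (s < u)%N ->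
  (1 <= r + s)%N || ~~ odd p -> even_end s T -> even_pre s T.
Proof.
move=> hs hrs he i /he ->; congr ((Y _ - Y _) / _ * _).
  by rewrite /upd_D lm_subn lt_subn; lia.
rewrite /upd_A lm_subn lt_subn; suff -> : lutilde p s.+1 = (2 * rho)%N by lia.
case/orP: hrs => [h|/negbTE op]; first by apply: lutilde_reg; lia.
by rewrite /lutilde op.
Qed.

Lemma in_range_prog (b : int) (N : nat) (K : seq int) : (0 < N)%N ->
  in_range (K ++ prog b N) -> 0 <= b /\ b + 2 * N%:Z - 2 <= w.
Proof.
case: N => [//|N] _; rewrite /in_range all_cat => /andP[_ /[dup]].
rewrite {1}progS progSr all_rcons /= => /andP[h _] /andP[h' _]; split; lia.
Qed.

(** By the recursion for [c], the prefactor [D - A] over the old factor equals [C - B] over the new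
    one. The same trade gives [odd_upd_end]. *)
Lemma even_pre_upd (s : nat) (T : pair_seq R -> R) : (s < u)%N ->
  even_pre s T -> even_upd s.+1 T.
Proof.
move=> hs he i.
have -> : (u + r + s.+1).-1 = (u + r + s)%N by lia.
have -> : (u - s.+1).+1 = (u - s)%N by lia.
move=> hK; rewrite he // c_evenS.
have hi : even_range w (lm p s.+1) i.
  move/in_range_prog: hK; rewrite /even_range lm_subn => /(_ _)[]; lia.
have n0 := lt0r_neq0 (upd_num Ystrict hi).
by rewrite -div_swap.
Qed.

Lemma odd_upd_end (s : nat) (T : pair_seq R -> R) : (s < u)%N ->
  (1 <= r + s)%N -> odd_upd s T -> odd_end s T.
Proof.
move=> hs hrs ho i hK; rewrite ho // c_oddS // -subn1.
have hi : odd_range w (lm p s) i.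
  move/in_range_prog: hK; rewrite /odd_range lm_subn => /(_ _)[]; lia.
have n0 := lt0r_neq0 (prd_num Ystrict hs hi).
by rewrite -div_swap.
Qed.

(** [ddiff4] around [2i + 1], with the even neighbours [2i] and [2i + 2]. *)
Lemma undo_update_odd_upd (s : nat) (T : pair_seq R -> R) : linear_form T ->
  (s < u)%N -> (1 <= r + s)%N || ~~ odd p ->
  even_pre s T -> odd_end s T -> odd_upd s.+1 (undo_update p Y s.+1 T).
Proof.
move=> hT hs hrs he ho i; have hrho : (rho <= 1)%N by case: odd.
have eS : (u - s.+1).+1 = (u - s)%N by lia.
have ea : (u + r + s.+1)%N = (u + r + s).+1 by lia.
have ec : (r + s.+1 - 1)%N = (r + s)%N by lia.
rewrite /even_pre in he; rewrite /odd_end in ho; rewrite eS ea ec.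
have eD : prd_D p s.+1 i = 2 * i + 2 * (u + r + s)%N%:Z + 2.
  by rewrite /prd_D lm_subn lt_subn; lia.
have eA : prd_A p s.+1 i = 2 * i - 2 * (u + r + s)%N%:Z + 2 * rho%:Z.
  by rewrite /prd_A lm_subn lt_subn lttilde_reg //; lia.
have euA : upd_A p s.+1 i = 2 * i - 2 * (u + r + s)%N%:Z + 2 * rho%:Z.
  rewrite /upd_A lm_subn lt_subn; suff -> : lutilde p s.+1 = (2 * rho)%N by lia.
  case/orP: hrs => [h|/negbTE op]; first by apply: lutilde_reg; lia.
  by rewrite /lutilde op.
have euB : upd_B p s.+1 i = 2 * i - 2 * (u - s)%N%:Z + 1.
  by rewrite /upd_B lm_subn; lia.
have euC : upd_C p s.+1 (i + 1) = 2 * i + 2 * (u - s)%N%:Z + 1.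
  by rewrite /upd_C lm_subn; lia.
have euD : upd_D p s.+1 (i + 1) = 2 * i + 2 * (u + r + s)%N%:Z + 2.
  by rewrite /upd_D lm_subn lt_subn; lia.
have epC : prd_C p s i = 2 * i + 2 * (u - s)%N%:Z + 1 by [].
have epB : prd_B p s i = 2 * i - 2 * (u - s)%N%:Z + 1 by [].
have hra : (rho <= 2 * (u + r + s))%N by lia.
have hm : (0 < u - s)%N by lia.
have hma : (u - s <= u + r + s)%N by lia.
have hs1 : (s <= u)%N by lia.
have hs2 : (0 < s.+1 <= u)%N by lia.
have hru : (r + s < r + u)%N by lia.
set a := (u + r + s)%N in he ho eD eA euA euD hra hma *.
have em : lm p s = (u - s)%N by [].
have em1 : lm p s.+1 = (u - s).-1 by rewrite /lm; lia.
set m := (u - s)%N in he ho euB euC epC epB hm hma em em1 *.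
have [h1 h2 h3 h4 h5] := @oset_exchange rho a m i hrho hra hm.
set A := _ - 2 * a%:Z + _ in h1 h3 h5 eA euA; set B := _ - 2 * m%:Z + 1 in h2 h3 h5 euB epB.
set C := _ + 1 in h2 h4 h5 euC epC; set D := _ + 2 in h1 h4 h5 eD euD.
rewrite (in_range_perm h1) => /and3P[hA hD hF].
have hB : 0 <= B <= w by move: hA hD; rewrite /A /B /D; lia.
have hC : 0 <= C <= w by move: hA hD; rewrite /A /C /D; lia.
have hi : 0 <= 2 * i /\ 2 * i + 2 <= w.
  by move: hA hD; rewrite /A /D; lia.
have hrg m' : [/\ even_range w m' i, even_range w m' (i + 1) & odd_range w m' i].
  by case: hi => hi1 hi2; rewrite /even_range /odd_range; split; lia.
have n1 : c_even p Y s i != 0.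
  by apply: (c_even_neq0 Ystrict hs1); case: (hrg (lm p s)).
have n2 : c_even p Y s (i + 1) != 0.
  by apply: (c_even_neq0 Ystrict hs1); case: (hrg (lm p s)).
have d1 : Y (upd_D p s.+1 i) - Y A != 0.
  by rewrite -euA; apply/lt0r_neq0/(upd_den Ystrict hs2); case: (hrg (lm p s.+1)).
have d2 : Y D - Y (upd_A p s.+1 (i + 1)) != 0.
  by rewrite -euD; apply/lt0r_neq0/(upd_den Ystrict hs2); case: (hrg (lm p s.+1)).
have r5 : in_range [:: A, B, C, D & oset rho a m i].
  by rewrite /in_range /= hA hB hC hD.
have inj5 : injseq Y [:: A, B, C, D & oset rho a m i].
  by apply: in_range_inj r5; rewrite -(perm_uniq h5) oset_uniq.
have ho' : T (odd_delta R i) = (Y C - Y B) / c_odd p Y (r + s) i * dd [:: B, C & oset rho a m i].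
  rewrite ho; last by rewrite (in_range_perm h2) /in_range /= hB hC.
  by rewrite (ddiff_perm _ _ h2) epC epB.
have he1 : T (even_delta R i) = (Y (upd_D p s.+1 i) - Y A) / c_even p Y s i
    * dd [:: A, B & oset rho a m i].
  rewrite he; last by rewrite (in_range_perm h3) /in_range /= hA hB.
  by rewrite (ddiff_perm _ _ h3) euA.
have he2 : T (even_delta R (i + 1)) = (Y D - Y (upd_A p s.+1 (i + 1)))
    / c_even p Y s (i + 1) * dd [:: C, D & oset rho a m i].
  rewrite he; last by rewrite (in_range_perm h4) /in_range /= hC hD.
  by rewrite (ddiff_perm _ _ h4) euD.
have := update_sub p Y s.+1 (i + 1); rewrite addrK => hU.
rewrite undo_update_odd // ho' he1 he2 update_diag hU eA eD euA euB euC euD.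
rewrite !subn1 addnS /= (ddiff_perm _ _ h1).
exact: exchange_sumN (ddiff4 g inj5).
Qed.

End Backward.

Lemma exchange_sum2 (F : fieldType) (e a c n d d1 x z t : F) :
  n != 0 -> d1 != 0 -> d * t = a * x + c * z ->
  a / e * x + n / e * (c / d1) * (d1 / n * z) = d / e * t.
Proof.
move=> h1 h3 h; rewrite [RHS]mulrAC h.
have -> : n / e * (c / d1) * (d1 / n * z) = (n / n) * (d1 / d1) * (c * z / e) by ring.
by rewrite !divff //; ring.
Qed.

(** * First transposed step and the induction on the steps *)

Section BackwardInit.
Variables (R : realType) (p : nat) (Y : int -> R) (w : int) (g : R -> R).
Variable T : pair_seq R -> R.
Hypothesis p_gt0 : (1 <= p)%N.
Hypothesis Ystrict : forall i j, i < j -> 0 < j -> i < w -> Y i < Y j.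
Hypothesis T_linear : linear_form T.

Local Notation u := (lu p).
Local Notation r := (lr p).
Local Notation rho := (nat_of_bool (odd p)).
Local Notation dd := (ddiff Y g).

Definition support_knots (l : int) : seq int := consec (l - (p./2)%:Z) p.+1.

Hypothesis T_even : forall i, in_range w (support_knots (2 * i)) ->
  T (even_delta R i) =
  (Y (2 * i + (uphalf p)%:Z) - Y (2 * i - (p./2)%:Z)) * dd (support_knots (2 * i)).
Hypothesis T_odd : forall i, in_range w (support_knots (2 * i + 1)) ->
  T (odd_delta R i) =
  (Y (2 * i + 1 + (uphalf p)%:Z) - Y (2 * i + 1 - (p./2)%:Z)) * dd (support_knots (2 * i + 1)).

(** With [c = 1] the fine B-splines start the induction: in the [upd] form if the scheme begins with
    a prediction, in the [pre] and [end] forms if it begins with an update. For odd [p], one of the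
    two parities has to await a three knot exchange. *)
Lemma even_upd_init : r = 1%N -> ~~ odd p -> even_upd p Y w g 0 T.
Proof.
move=> r1 /negbTE op i; have hpE := lu_lr p; rewrite r1 op in hpE.
have hK : perm_eq (support_knots (2 * i)) (eset rho (u + r + 0).-1 (u - 0).+1 i).
  by rewrite op r1; apply: consec_split; lia.
rewrite -(in_range_perm w hK) => /T_even ->.
rewrite (ddiff_perm _ _ hK) divr1; congr ((Y _ - Y _) * _);
  by rewrite /upd_C /upd_B lm_subn; lia.
Qed.

Lemma odd_upd_init : r = 1%N -> odd_upd p Y w g 0 T.
Proof.
move=> r1 i; have hpE := lu_lr p; rewrite r1 in hpE.
have hK : perm_eq (support_knots (2 * i + 1)) (oset rho (u + r + 0) (u - 0).+1 i).
  by rewrite r1; apply: consec_split; lia.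
rewrite -(in_range_perm w hK) => /T_odd ->.
have -> : (r + 0 - 1 = 0)%N by lia.
rewrite (ddiff_perm _ _ hK) divr1; congr ((Y _ - Y _) * _);
  by rewrite /prd_D /prd_A lm_subn lt_subn ?lttilde0; lia.
Qed.

Lemma even_pre_init : r = 0%N -> even_pre p Y w g 0 T.
Proof.
move=> r0 i; have hpE := lu_lr p; rewrite r0 in hpE.
have hK : perm_eq (support_knots (2 * i)) (eset rho (u + r + 0) (u - 0) i).
  by rewrite r0; apply: consec_split; lia.
rewrite -(in_range_perm w hK) => /T_even ->.
have hl : (odd p -> lutilde p 1 = 1%N) /\ (~~ odd p -> lutilde p 1 = 0%N).
  by rewrite /lutilde r0; case: odd.
rewrite (ddiff_perm _ _ hK) divr1; congr ((Y _ - Y _) * _);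
  by rewrite /upd_D /upd_A lm_subn lt_subn; lia.
Qed.

Lemma odd_end_init : r = 0%N -> ~~ odd p -> odd_end p Y w g 0 T.
Proof.
move=> r0 /negbTE op i; have hpE := lu_lr p; rewrite r0 op in hpE.
have hK : perm_eq (support_knots (2 * i + 1)) (oset rho (u + r + 0) (u - 0).+1 i).
  by rewrite r0 op; apply: consec_split; lia.
rewrite -(in_range_perm w hK) => /T_odd ->.
have c1 : c_odd p Y (r + 0) i = 1 by rewrite r0.
rewrite c1 (ddiff_perm _ _ hK) divr1; congr ((Y _ - Y _) * _);
  by rewrite /prd_C /prd_B lm_subn; lia.
Qed.

(** Since [A = B] in the first update, its diagonal entry is zero and [ddiff3] applies. In
    [even_end0] the first prediction is treated likewise. *)
Lemma odd_upd1 : r = 0%N -> odd p -> odd_upd p Y w g 1 (undo_update p Y 1 T).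
Proof.
move=> r0 op i; have hpE := lu_lr p; rewrite r0 op in hpE.
have hu : (0 < u)%N by lia.
have hra : (1 <= 2 * u)%N by lia.
have -> : (u + r + 1 = u.+1)%N by lia.
have -> : ((u - 1).+1 = u)%N by lia.
have -> : (r + 1 - 1 = 0)%N by lia.
have eD : prd_D p 1 i = 2 * i + 2 * u%:Z + 2 by rewrite /prd_D lm_subn lt_subn r0; lia.
have eA : prd_A p 1 i = 2 * i - 2 * u%:Z + 2 * 1%:Z.
  by rewrite /prd_A lm_subn lt_subn lttilde_reg // op r0; lia.
have euBA : upd_B p 1 i = upd_A p 1 i.
  by rewrite /upd_A /upd_B lm_subn lt_subn lutilde1 ?op r0 //; lia.
have euC : upd_C p 1 (i + 1) = 2 * i + 2 * u%:Z + 1.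
  by rewrite /upd_C lm_subn; lia.
have euD : upd_D p 1 (i + 1) = 2 * i + 2 * u%:Z + 2.
  by rewrite /upd_D lm_subn lt_subn r0; lia.
have hs2 : (0 < 1 <= u)%N by lia.
rewrite op /=.
have [h1 _ _ h4 h5] := @oset_exchange 1 u u i isT hra hu.
rewrite eA eD.
set A := _ - 2 * u%:Z + _ in h1 h5 eA *; set B := _ - 2 * u%:Z + 1 in h5.
set C := _ + 1 in h4 h5 euC; set D := _ + 2 in h1 h4 h5 eD euD *.
have hY1 : Y (2 * i + 1 + (uphalf p)%:Z) = Y C by congr (Y _); rewrite /C; lia.
have hY2 : Y (2 * i + 1 - (p./2)%:Z) = Y A by congr (Y _); rewrite /A; lia.
have hK : perm_eq (support_knots (2 * i + 1)) [:: A, C & oset 1 u u i].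
  apply: (perm_trans (y := prog A (2 * u) ++ prog (2 * i - 2 * u%:Z + 3) (2 * u))).
    by apply: consec_split; rewrite /A; lia.
  rewrite /oset; have -> : prog A (2 * u) = A :: prog (A + 2) (2 * u - 1).
    have -> : (2 * u = (2 * u - 1).+1)%N by lia.
    by rewrite progS subSS subn0.
  have -> : prog (2 * i - 2 * u%:Z + 3) (2 * u) = rcons (prog (2 * i - 2 * u%:Z + 3) (2 * u - 1)) C.
    have e : (2 * u = (2 * u - 1).+1)%N by lia.
    by rewrite {1}e progSr; congr rcons; rewrite /C; lia.
  have -> : 2 * i - 2 * u%:Z + 2 + 2 * 1%:Z = A + 2 by rewrite /A; lia.
  by rewrite cat_cons perm_cons -rcons_cat perm_rcons.
rewrite (in_range_perm w h1) => /and3P[hA hD hF].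
have hC : 0 <= C <= w by move: hA hD; rewrite /A /C /D; lia.
have hi : 0 <= 2 * i /\ 2 * i + 2 <= w.
  by move: hA hD; rewrite /A /D; lia.
have r4 : in_range w [:: A, C, D & oset 1 u u i].
  by rewrite /in_range /= hA hC hD.
have inj4 : injseq Y [:: A, C, D & oset 1 u u i].
  apply: (in_range_inj Ystrict _ r4).
  have : uniq [:: A, B, C, D & oset 1 u u i] by rewrite -(perm_uniq h5) oset_uniq.
  by rewrite /= !inE !negb_or => /and5P[/and4P[_ -> -> ->] _ /andP[-> ->] -> ->].
have d1 : Y D - Y (upd_A p 1 (i + 1)) != 0.
  rewrite -euD; apply/lt0r_neq0/(upd_den Ystrict hs2).
  by case: hi => hi1 hi2; rewrite /even_range; lia.
(* The divisor 1 is the initial factor [c], kept visible for [exchange_sum2]. *)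
have ho' : T (odd_delta R i) = (Y C - Y A) / 1 * dd [:: A, C & oset 1 u u i].
  rewrite T_odd; last by rewrite (in_range_perm w hK) /in_range /= hA hC.
  by rewrite (ddiff_perm _ _ hK) divr1 hY1 hY2.
have he2 : T (even_delta R (i + 1)) = (Y D - Y (upd_A p 1 (i + 1)))
    / 1 * dd [:: C, D & oset 1 u u i].
  have := even_pre_init r0 (i := i + 1); rewrite r0 op /= addn0 addn0 subn0 euD.
  rewrite (in_range_perm w h4) (ddiff_perm _ _ h4); apply.
  by rewrite /in_range /= hC hD.
have := update_sub p Y 1 (i + 1); rewrite addrK => hU.
rewrite undo_update_odd // ho' he2 update_diag hU euBA euC euD.
rewrite subrr mul0r mulr0 mul0r subr0 r0 /= (ddiff_perm _ _ h1).
rewrite -[RHS](exchange_sum2 1 (oner_neq0 R) d1 (ddiff3 g inj4)).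
by rewrite !mulNr opprK.
Qed.

Lemma even_end0 : r = 1%N -> odd p -> even_end p Y w g 0 (undo_predict p Y 0 T).
Proof.
move=> r1 op i; have hpE := lu_lr p; rewrite r1 op in hpE.
have -> : (u + r + 0 = u.+1)%N by lia.
have -> : (u - 0 = u)%N by lia.
have eD : prd_D p 0 i = 2 * i + 2 * u%:Z + 2 by rewrite /prd_D lm_subn lt_subn r1; lia.
have eC : prd_C p 0 i = 2 * i + 2 * u%:Z + 1 by rewrite /prd_C lm_subn; lia.
have eBA : prd_B p 0 (i - 1) = prd_A p 0 (i - 1).
  by rewrite /prd_A /prd_B lm_subn lt_subn lttilde0 op r1; lia.
have hrs : (1 <= r + 0)%N by lia.
rewrite op /=.
have [h1 _ h3 _ h5] := @eset_exchange 1 u u i isT.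
have -> : 2 * i + 2 * u.+1%:Z = 2 * i + 2 * u%:Z + 2 by lia.
have -> : 2 * i - 2 * u.+1%:Z + 2 * 1%:Z = 2 * i - 2 * u%:Z - 2 + 2 * 1%:Z by lia.
set A := _ - 2 + _ in h1 h5 *; set B := _ - 1 in h5.
set C := _ + 1 in h3 h5 eC; set D := _ + 2 in h1 h3 h5 eD *.
have hY1 : Y (2 * i + (uphalf p)%:Z) = Y C by congr (Y _); rewrite /C; lia.
have hY2 : Y (2 * i - (p./2)%:Z) = Y A by congr (Y _); rewrite /A; lia.
have hK : perm_eq (support_knots (2 * i)) [:: A, C & eset 1 u u i].
  apply: (perm_trans (y := prog A (2 * u).+1 ++ prog (2 * i - 2 * u%:Z + 1) (2 * u).+1)).
    by apply: consec_split; rewrite /A; lia.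
  rewrite progS progSr /eset.
  have -> : 2 * i - 2 * u%:Z + 1 + 2 * (2 * u)%N%:Z = C by rewrite /C; lia.
  have -> : 2 * i - 2 * u%:Z + 2 * 1%:Z = A + 2 by rewrite /A; lia.
  by rewrite addnK cat_cons perm_cons -rcons_cat perm_rcons.
rewrite (in_range_perm w h1) => /and3P[hA hD hF].
have hC : 0 <= C <= w by move: hA hD; rewrite /A /C /D; lia.
have hi : 0 <= 2 * i /\ 2 * i + 2 <= w.
  by move: hA hD; rewrite /A /D; lia.
have r4 : in_range w [:: A, C, D & eset 1 u u i].
  by rewrite /in_range /= hA hC hD.
have inj4 : injseq Y [:: A, C, D & eset 1 u u i].
  apply: (in_range_inj Ystrict _ r4).
  have : uniq [:: A, B, C, D & eset 1 u u i] by rewrite -(perm_uniq h5) eset_uniq.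
  by rewrite /= !inE !negb_or => /and5P[/and4P[_ -> -> ->] _ /andP[-> ->] -> ->].
have d1 : Y D - Y (prd_A p 0 i) != 0.
  rewrite -eD; apply/lt0r_neq0/(prd_den Ystrict hrs).
  by case: hi => hi1 hi2; rewrite /odd_range; lia.
have he' : T (even_delta R i) = (Y C - Y A) / 1 * dd [:: A, C & eset 1 u u i].
  rewrite T_even; last by rewrite (in_range_perm w hK) /in_range /= hA hC.
  by rewrite (ddiff_perm _ _ hK) divr1 hY1 hY2.
have ho1 : T (odd_delta R i) = (Y D - Y (prd_A p 0 i))
    / 1 * dd [:: C, D & eset 1 u u i].
  have := odd_upd_init r1 (i := i); rewrite r1 op /= addn0 addn1 subn0 eD.
  rewrite (in_range_perm w h3) (ddiff_perm _ _ h3); apply.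
  by rewrite /in_range /= hC hD.
have := predict_sup p Y 0 (i - 1); rewrite subrK => hP.
rewrite undo_predict_even // he' ho1 predict_diag hP eBA eC eD.
rewrite subrr mul0r mulr0 mul0r addr0 r1 /= (ddiff_perm _ _ h1).
exact: exchange_sum2 (oner_neq0 R) d1 (ddiff3 g inj4).
Qed.

(** Induction from the first executed step on. The odd part stops before [s = u], where its
    prefactor would divide by the vanishing odd factor. *)
Lemma undo_upto_end (s : nat) : (1 <= r + s)%N -> (s <= u)%N ->
  even_end p Y w g s (undo_upto p Y T s)
  /\ ((s < u)%N -> odd_end p Y w g s (undo_upto p Y T s)).
Proof.
have hr := lr_le1 p.
have step s' : (s' < u)%N ->
    even_pre p Y w g s' (undo_upto p Y T s') ->
    odd_upd p Y w g s'.+1 (undo_update p Y s'.+1 (undo_upto p Y T s')) ->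
    even_end p Y w g s'.+1 (undo_upto p Y T s'.+1)
    /\ ((s'.+1 < u)%N -> odd_end p Y w g s'.+1 (undo_upto p Y T s'.+1)).
  move=> hs' he ho; have hT := undo_uptoP p Y s' T_linear.
  have hT' := undo_updateP p Y s'.+1 hT.
  rewrite undo_uptoS; split=> [|hs''].
    apply: undo_predict_end => //; [lia | by left |].
    by move=> i hi; rewrite undo_update_even; apply: (even_pre_upd Ystrict hs' he).
  apply: (odd_upd_end Ystrict hs''); first lia.
  by move=> i hi; rewrite undo_predict_odd; apply: ho.
elim: s => [|s IH] hrs hs.
  have r1 : r = 1%N by lia.
  rewrite undo_upto0 r1 /=; split=> [|hu].
    case op: (odd p); first by apply: even_end0.
    apply: undo_predict_end => //; first by right; rewrite op.
      by apply: even_upd_init; rewrite ?op.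
    exact: odd_upd_init.
  apply: (odd_upd_end Ystrict hu) => // i hi; rewrite undo_predict_odd.
  exact: (odd_upd_init r1).
case: (posnP (r + s)) => [rs0|rs1]; last first.
  have [he ho] := IH rs1 (ltnW hs).
  have hrs' : (1 <= r + s)%N || ~~ odd p by rewrite rs1.
  have he' := even_end_pre hs hrs' he.
  apply: step => //; apply: undo_update_odd_upd => //; last exact: ho.
  exact: undo_uptoP.
(* No step precedes here: the first update acts on the B-splines themselves. *)
have r0 : r = 0%N by lia.
have s0 : s = 0%N by lia.
rewrite s0 in hs *; have he := even_pre_init r0.
have ho : odd_upd p Y w g 1 (undo_update p Y 1 T).
  case op: (odd p); first exact: odd_upd1.
  apply: undo_update_odd_upd => //; first by rewrite op orbT.
  by apply: odd_end_init; rewrite ?op.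
have e0 : undo_upto p Y T 0 = T by rewrite undo_upto0 r0.
by apply: step => //; rewrite e0.
Qed.

End BackwardInit.

(** * The refinement equation *)

Lemma linear_form_scale (R : realType) (T : pair_seq R -> R) (c : R)
    (a : pair_seq R) : linear_form T ->
  T (fun k => c * a.1 k, fun k => c * a.2 k) = c * T a.
Proof.
move=> hT; pose z : pair_seq R := (fun => 0, fun => 0).
have z0 : T z = 0.
  have := hT 1 z z; rewrite mul1r /z /= mul1r addr0 -/z => e.
  by apply: (addrI (T z)); rewrite addr0 -e.
have := hT c a z; rewrite z0 addr0 => <-.
by congr (T (_, _)); apply/funext => k; rewrite addr0.
Qed.

(** The form on which the transposed steps act: the value at [z] of the fine spline with
    coefficients [eo]. *)
Definition fine_sum (R : realType) (p n' : nat) (Y : int -> R) (z : R)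
    (eo : pair_seq R) : R :=
  \sum_(l < n') (if odd l then eo.2 (l./2)%:Z else eo.1 (l./2)%:Z)
     * bspline Y p l%:Z z.

Section FineSum.
Variables (R : realType) (p n' : nat) (Y : int -> R) (z : R).

Lemma fine_sum_linear : linear_form (fine_sum p n' Y z).
Proof.
move=> c a b; rewrite /fine_sum mulr_sumr -big_split /=; apply: eq_bigr => l _.
by case: ifP => _; ring.
Qed.

Lemma fine_sum_delta (l0 : nat) (eo : pair_seq R) : (l0 < n')%N ->
  (forall l : nat, (if odd l then eo.2 (l./2)%:Z else eo.1 (l./2)%:Z)
     = (l == l0)%:R) ->
  fine_sum p n' Y z eo = bspline Y p l0%:Z z.
Proof.
move=> hl h; rewrite /fine_sum (bigD1 (Ordinal hl)) //= h eqxx mul1r.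
rewrite big1 ?addr0 // => l hne; rewrite h.
by have -> : (val l == l0) = false; [apply/negbTE | rewrite mul0r].
Qed.

Lemma fine_sum_even (i : int) : 0 <= 2 * i < n'%:Z ->
  fine_sum p n' Y z (even_delta R i) = bspline Y p (2 * i) z.
Proof.
move=> hi; rewrite (fine_sum_delta (l0 := absz (2 * i)%R)); first last.
- move=> l /=; case ol: (odd l); first by have -> : (l == absz (2 * i)%R) = false by lia.
  by congr (nat_of_bool _)%:R; lia.
- by lia.
by congr (bspline _ _ _ _); lia.
Qed.

Lemma fine_sum_odd (i : int) : 0 <= 2 * i + 1 < n'%:Z ->
  fine_sum p n' Y z (odd_delta R i) = bspline Y p (2 * i + 1) z.
Proof.
move=> hi; rewrite (fine_sum_delta (l0 := absz (2 * i + 1)%R)); first last.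
- move=> l /=; case ol: (odd l); last by have -> : (l == absz (2 * i + 1)%R) = false by lia.
  by congr (nat_of_bool _)%:R; lia.
- by lia.
by congr (bspline _ _ _ _); lia.
Qed.

Lemma fine_sum_even0 (i : int) :
  (0 <= 2 * i < n'%:Z -> bspline Y p (2 * i) z = 0) ->
  fine_sum p n' Y z (even_delta R i) = 0.
Proof.
move=> h; case: (boolP (0 <= 2 * i < n'%:Z)) => hi.
  by rewrite fine_sum_even // h.
apply: big1 => l _ /=; case: ifP => ol; first by rewrite mul0r.
have -> : ((l./2)%:Z == i) = false by have := ltn_ord l; lia.
by rewrite mul0r.
Qed.

Lemma fine_sum_odd0 (i : int) :
  (0 <= 2 * i + 1 < n'%:Z -> bspline Y p (2 * i + 1) z = 0) ->
  fine_sum p n' Y z (odd_delta R i) = 0.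
Proof.
move=> h; case: (boolP (0 <= 2 * i + 1 < n'%:Z)) => hi.
  by rewrite fine_sum_odd // h.
apply: big1 => l _ /=; case: ifP => ol; last by rewrite mul0r.
have -> : ((l./2)%:Z == i) = false by have := ltn_ord l; lia.
by rewrite mul0r.
Qed.

(** Undoing the rescaling multiplies the delta sequence by the factor [c] at [2k], which linearity
    pulls out. *)
Lemma refinement_sum (k : nat) :
  \sum_(l < n') refinement_mx p Y l k * bspline Y p l%:Z z
  = c_even p Y (lu p) k%:Z
    * undo_upto p Y (fine_sum p n' Y z) (lu p) (even_delta R k%:Z).
Proof.
rewrite -linear_form_scale; last exact: undo_uptoP fine_sum_linear.
rewrite /undo_upto /fine_sum; apply: eq_bigr => l _; congr (_ * _).
rewrite /refinement_mx /inverse_lifting /lift_indices addnC.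
have e1 : (fun i : int => rescale_mx p Y i * (i == k%:Z)%:R)
    = fun i => c_even p Y (lu p) k%:Z * (i == k%:Z)%:R.
  by apply/funext => i; case: eqP => [->|]; rewrite ?mulr0.
have e2 : (fun => c_even p Y (lu p) k%:Z * 0) = (fun => 0 : R) :> (int -> R).
  by apply/funext => i; rewrite mulr0.
rewrite /= e1 e2.
by case: (foldl _ _ _).
Qed.

End FineSum.

Lemma ddiff_map (R : fieldType) (X Y : int -> R) (g : R -> R) (h : int -> int)
    (K : seq int) : injective h -> (forall i, i \in K -> Y (h i) = X i) ->
  ddiff Y g [seq h i | i <- K] = ddiff X g K.
Proof.
move=> hi hYX; rewrite /ddiff big_map !big_seq; apply: eq_bigr => i iK.
rewrite hYX // big_map; congr (_ / _).
rewrite [LHS]big_seq_cond [RHS]big_seq_cond; apply: eq_big => j.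
  by rewrite (inj_eq hi).
by case/andP => jK _; rewrite hYX.
Qed.

Lemma prog_double (b : int) (N : nat) :
  prog (2 * b) N = [seq 2 * i | i <- consec b N].
Proof. by rewrite /prog /consec -map_comp; apply: eq_map => i /=; lia. Qed.

Section Knots.
Variables (R : realType) (n : nat) (x : nat -> R).
Hypothesis n_gt0 : (0 < n)%N.
Hypothesis x_incr : forall k, (k.+1 < n)%N -> x k < x k.+1.

Lemma knot_const (i : int) : n%:Z - 1 <= i -> knot n x i = knot n x (n%:Z - 1).
Proof.
case: n n_gt0 => [//|m] _; have -> : m.+1%:Z - 1 = m%:Z by lia.
by case: i => // i hi; rewrite /knot /=; congr x; lia.
Qed.

Lemma knot_inner_lt (i j : int) : 0 <= i -> i < j -> i < n%:Z - 1 ->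
  knot n x i < knot n x j.
Proof. by move=> i0 ij iw; apply: knot_lt => //; lia. Qed.

(** From the last knot on, all knots of the support coincide. Before it, the first knot is simple
    and order at least two gives the value zero there too; order 1 would give one. *)
Lemma nspl_right0 (p : nat) (i : int) (z : R) :
  (1 < p)%N \/ n%:Z - 1 <= i -> 0 <= i -> z <= knot n x i ->
  nspl (knot n x) p i z = 0.
Proof.
move=> hp i0 hz; have mono a b : a <= b -> knot n x a <= knot n x b by apply: knot_le.
case: (lerP (n%:Z - 1) i) => hi.
  apply: nspl_const => //; rewrite knot_const // [RHS]knot_const //; lia.
case: hp => hp; last lia.
by apply: nspl_start => //; apply: knot_inner_lt => //; lia.
Qed.

End Knots.

Lemma bspline_refinement (R : realType) (p n n' k : nat) (x x' : nat -> R) (z : R) :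
  let X := knot n x in let Y := knot n' x' in
  (1 <= p)%N -> (k < n)%N -> n = uphalf n' -> (1 < n')%N ->
  (forall i, (i.+1 < n)%N -> x i < x i.+1) ->
  (forall i, (i.+1 < n')%N -> x' i < x' i.+1) ->
  nested_upto X Y (k%:Z + (uphalf p)%:Z) ->
  X (p%:Z - 1) <= z <= X (n%:Z - p%:Z) ->
  bspline X p k%:Z z = \sum_(l < n') refinement_mx p Y l k * bspline Y p l%:Z z.
Proof.
move=> X Y hp hk nE hn' xincr xincr' hXY /andP[hlo hhi].
have n0 : (0 < n)%N by lia.
have n'0 : (0 < n')%N by lia.
have Xmono i j : i <= j -> X i <= X j by apply: knot_le.
have Ymono i j : i <= j -> Y i <= Y j by apply: knot_le.
have Ystrict i j : i < j -> 0 < j -> i < n'%:Z - 1 -> Y i < Y j by apply: knot_lt.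
have hpf : (p = p./2 + uphalf p)%N by lia.
have hpE := lu_lr p; have hr := lr_le1 p.
have hcE : (uphalf p = 2 * lu p + lr p)%N by lia.
rewrite refinement_sum bspline_nspl.
have Tlin := fine_sum_linear p n' Y z.
(* The support ends at or before the interior interval. Fine B-splines up to index [2k + ceil(p/2)]
   vanish at [z], and the band reaches up by [r + 2u = ceil(p/2)]. *)
case: (ltnP k p./2) => hkf.
  have hz : X (k%:Z + (uphalf p)%:Z) <= z by apply: le_trans hlo; apply: Xmono; lia.
  rewrite nspl_ge //; last by have -> : k%:Z - (p./2)%:Z + p%:Z = k%:Z + (uphalf p)%:Z by lia.
  have hl l : l <= 2 * k%:Z + (uphalf p)%:Z -> bspline Y p l z = 0.
    move=> hl; rewrite bspline_nspl; apply: nspl_ge => //.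
    by apply: le_trans hz; rewrite -hXY //; apply: Ymono; lia.
  have v : vanish_below (2 * k%:Z + (uphalf p)%:Z) (fine_sum p n' Y z).
    by move=> i; split=> hi; [apply: fine_sum_even0 | apply: fine_sum_odd0] => _; apply: hl.
  rewrite (undo_upto_below p Y (lu p) Tlin v k%:Z).1 ?mulr0 //; lia.
(* The support starts at or after the interior interval. Fine B-splines from index [2k - floor(p/2)]
   on vanish at [z]; the band reaches down by [ceil(p/2)] less the parity of [p], that is
   [floor(p/2)]. *)
case: (leqP n (k + uphalf p)) => hkn.
  have hz : z <= X (k%:Z - (p./2)%:Z) by apply: le_trans hhi _; apply: Xmono; lia.
  have hXk : Y (2 * (k%:Z - (p./2)%:Z)) = X (k%:Z - (p./2)%:Z) by apply: hXY; lia.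
  rewrite (nspl_right0 n0 xincr) //; [|lia..].
  have hl l : 0 <= l -> 2 * k%:Z - (p./2)%:Z <= l -> bspline Y p l z = 0.
    move=> l0 hl; rewrite bspline_nspl; apply: (nspl_right0 n'0 xincr'); last first.
    - by apply: le_trans hz _; rewrite -hXk; apply: Ymono; lia.
    - by lia.
    (* For [p = 1], a fine knot beyond [2n - 2] would contradict the nesting at [n], by which
       [Y (2n)] equals [Y (2n - 2)]. *)
    case: (ltnP 1 p) => p1; first by left.
    right; rewrite leNgt; apply/negP => hlw.
    have p1' : p = 1%N by lia.
    have e1 : Y (2 * n%:Z) = X n%:Z by apply: hXY; lia.
    have e2 : Y (2 * (n%:Z - 1)) = X (n%:Z - 1) by apply: hXY; lia.
    have e3 : X n%:Z = X (n%:Z - 1) by apply: knot_const => //; lia.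
    have : Y (2 * (n%:Z - 1)) < Y (2 * n%:Z) by apply: Ystrict; lia.
    by rewrite e1 e2 e3 ltxx.
  have v : vanish_above (2 * k%:Z - (p./2)%:Z) (fine_sum p n' Y z).
    move=> i; split=> hi; [apply: fine_sum_even0 | apply: fine_sum_odd0] => /andP[h0 _];
    exact: hl.
  have hru : (1 <= lr p + lu p)%N by lia.
  rewrite (undo_upto_above Y Tlin hru v k%:Z).1 ?mulr0 //; lia.
(* The coarse support now lies inside the grid, so its knots are simple and the divided differences
   apply. *)
have hsupp l : in_range (n'%:Z - 1) (support_knots p l) ->
    0 <= l - (p./2)%:Z /\ l + (uphalf p)%:Z <= n'%:Z - 1.
  move=> /allP hS; have := hS (l - (p./2)%:Z); have := hS (l + (uphalf p)%:Z).
  rewrite !mem_consec => h1 h2; split.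
    have /andP[] // : 0 <= l - (p./2)%:Z <= n'%:Z - 1 by apply: h2; lia.
  have /andP[] // : 0 <= l + (uphalf p)%:Z <= n'%:Z - 1 by apply: h1; lia.
have hB l : in_range (n'%:Z - 1) (support_knots p l) -> bspline Y p l z =
    (Y (l + (uphalf p)%:Z) - Y (l - (p./2)%:Z)) * ddiff Y (tpow z p.-1) (support_knots p l).
  move=> /hsupp[h1 h2]; rewrite bspline_nspl.
  have hp' : p = p.-1.+1 by lia.
  rewrite {1}hp' nspl_ddiff; last by move=> i j *; apply: Ystrict; lia.
  rewrite -hp'; congr ((Y _ - _) * _); lia.
have Teven i : in_range (n'%:Z - 1) (support_knots p (2 * i)) ->
    fine_sum p n' Y z (even_delta R i) =
    (Y (2 * i + (uphalf p)%:Z) - Y (2 * i - (p./2)%:Z))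
    * ddiff Y (tpow z p.-1) (support_knots p (2 * i)).
  by move=> hS; rewrite -hB // fine_sum_even //; case: (hsupp _ hS); lia.
have Todd i : in_range (n'%:Z - 1) (support_knots p (2 * i + 1)) ->
    fine_sum p n' Y z (odd_delta R i) =
    (Y (2 * i + 1 + (uphalf p)%:Z) - Y (2 * i + 1 - (p./2)%:Z))
    * ddiff Y (tpow z p.-1) (support_knots p (2 * i + 1)).
  by move=> hS; rewrite -hB // fine_sum_odd //; case: (hsupp _ hS); lia.
have hru : (1 <= lr p + lu p)%N by lia.
have [hend _] := undo_upto_end hp Ystrict Tlin Teven Todd hru (leqnn (lu p)).
(* After [u] steps exactly the doubled indices of the coarse support are left. *)
have hset : eset (odd p) (lu p + lr p + lu p) (lu p - lu p) k%:Z
    = [seq 2 * i | i <- consec (k%:Z - (p./2)%:Z) p.+1].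
  rewrite /eset subnn cats0 -prog_double; congr (prog _ _); lia.
rewrite hend; last first.
  rewrite hset; apply/allP => y /mapP[i]; rewrite mem_consec => hi ->; lia.
have c0 : c_even p Y (lu p) k%:Z != 0.
  by apply: (c_even_neq0 Ystrict) => //; rewrite /even_range /lm subnn; lia.
rewrite hset (ddiff_map _ (X := X)); first last.
- by move=> i; rewrite mem_consec => hi; apply: hXY; lia.
- by move=> i j; lia.
have -> : Y (2 * k%:Z + 2 * (lu p + lr p + lu p)%N%:Z) = X (k%:Z + (uphalf p)%:Z).
  by rewrite -hXY //; congr (Y _); lia.
have -> : Y (2 * k%:Z - 2 * (lu p + lr p + lu p)%N%:Z + 2 * (odd p)%:Z) = X (k%:Z - (p./2)%:Z).
  by rewrite -hXY; [congr (Y _) |]; lia.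
have hp' : p = p.-1.+1 by lia.
rewrite {1}hp' nspl_ddiff; last by move=> i j *; apply: (knot_inner_lt n0 xincr); lia.
rewrite -hp' mulrA [c_even _ _ _ _ * _]mulrC divfK //.
by congr ((X _ - _) * _); lia.
Qed.

Theorem proposition2 (R : realType) (L J : int) (n : int -> nat)
    (x : int -> nat -> R) (j : int) (p : nat)
    (hgrid : multilevel_grid L J n x) (hnest : two_nested L J n x)
    (hj : L <= j < J) (hp : (1 <= p)%N) :
  let X := knot (n j) (x j) in
  let Y := knot (n (j + 1)) (x (j + 1)) in
  (forall (q : nat) (a b : int -> R), (q < p)%N ->
     power_coefs p q (n (j + 1)) Y a -> power_coefs p q (n j) X b ->
     (forall k : nat, (k < n j)%N ->
        nested_upto X Y (k%:Z + (uphalf p)%:Z - 1) ->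
        (lifting p Y a).1 k%:Z = b k%:Z) /\
     (forall k : nat, (k.+1 < n j)%N -> (lifting p Y a).2 k%:Z = 0)) /\
  (forall k : nat, (k < n j)%N ->
     nested_upto X Y (k%:Z + (uphalf p)%:Z) ->
     forall z : R, z \in `[X (p%:Z - 1), X ((n j)%:Z - p%:Z)] ->
       bspline X p k%:Z z =
       \sum_(l < n (j + 1)%R) refinement_mx p Y l k * bspline Y p l%:Z z).
Proof.
move=> X Y; have [nE _] := hnest j hj; have [xincr hn _] := hgrid.
have incr k : (k.+1 < n j)%N -> x j k < x j k.+1 by apply: xincr; lia.
have incr' k : (k.+1 < n (j + 1)%R)%N -> x (j + 1) k < x (j + 1) k.+1 by apply: xincr; lia.
have hnn := hn j hj.
(* The last fine index plays the role of [w]. *)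
have main q a b : (0 < n j)%N -> (q < p)%N ->
    power_coefs p q (n (j + 1)) Y a -> power_coefs p q (n j) X b ->
    _ := fun n0 hq => lifting_power_coefs (X := X) (Y := Y) (w := (n (j + 1))%:Z - 1)
      hq (fun i i' => knot_le incr n0) (fun i i' => knot_le incr' (ltnW (leq_ltn_trans n0 hnn)))
      (fun i i' => knot_lt incr' (leq_ltn_trans n0 hnn)).
split=> [q a b hq ha hb|k hk hXY z].
  split=> k hk; have n0 : (0 < n j)%N by lia.
    by move=> hXY; apply: (main q a b n0 hq ha hb).1 => //; lia.
  by apply: (main q a b n0 hq ha hb).2 => //; lia.
rewrite in_itv /= => hz.
by apply: (bspline_refinement hp hk nE _ incr incr' hXY hz); lia.
Qed.
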